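(* Let $\rho$ be a state on $\mathcal{H}=\mathcal{H}_A\otimes\mathcal{H}_B$, let $\mathcal{R}$ be a set of POVMs on $\mathcal{H}$ (the allowed effective measurements), let $E$ be an entanglement measure, and let $\mathcal{E}$ be the set of all states $\bar\sigma$ on $\mathcal{H}$ such that $\mathfrak{p}^*(\bar\sigma)\ge \mathfrak{q}^*(\rho)$ for every semiquantum nonlocal game. Let $\bar E(\rho)=\inf\{E(\bar\sigma):\bar\sigma\in\mathcal{E}\}$ be the effective entanglement. If there exists a state $\bar\rho\in\mathcal{E}$ such that $\mathfrak{p}^*(\bar\rho)=\mathfrak{q}^*(\rho)$ for all semiquantum nonlocal games, then $\bar E(\rho)=E(\bar\rho)$.
   Context: All Hilbert spaces are finite-dimensional; a state is a density operator. A semiquantum nonlocal game consists of finite index sets $\mathcal{S},\mathcal{T},\mathcal{X},\mathcal{Y}$, probability distributions $p$ on $\mathcal{S}$ and $q$ on $\mathcal{T}$, question states $\zeta^s$ ($s\in\mathcal{S}$) on a space $\mathcal{Q}_A$ and $\eta^t$ ($t\in\mathcal{T}$) on a space $\mathcal{Q}_B$ (not necessarily orthogonal), and a real payoff function $\mathfrak{p}(s,t,x,y)$. Two players share $\rho$ on $\mathcal{H}_A\otimes\mathcal{H}_B$. Alice measures a POVM $\{P_x\}_{x\in\mathcal{X}}$ on $\mathcal{Q}_A\otimes\mathcal{H}_A$ and Bob a POVM $\{Q_y\}_{y\in\mathcal{Y}}$ on $\mathcal{H}_B\otimes\mathcal{Q}_B$, giving $$\mu(x,y|s,t)=\mathrm{Tr}\big[(P_x\otimes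 Q_y)(\zeta^s\otimes\rho\otimes\eta^t)\big].$$ The optimal average payoff is $$\mathfrak{p}^*(\rho)=\max\sum_{s,t,x,y}p(s)q(t)\,\mathfrak{p}(s,t,x,y)\,\mu(x,y|s,t),$$ the maximum being over all choices of the two players' POVMs. For given $s,t$ the effective POVM on $\mathcal{H}_A\otimes\mathcal{H}_B$ is $\{\mathrm{Tr}_{\mathcal{Q}_A\mathcal{Q}_B}[(P_x\otimes Q_y)(\zeta^s\otimes \mathbf{1}\otimes\eta^t)]\}_{x,y}$. The quantity $\mathfrak{q}^*(\rho)$ is defined by the same formula as $\mathfrak{p}^*(\rho)$, except that the maximum (a supremum if not attained) is only over those POVMs of the players whose effective POVMs on $\mathcal{H}_A\otimes\mathcal{H}_B$ belong to $\mathcal{R}$. An entanglement measure $E$ is a real-valued functional on bipartite states that is zero exactly on separable states, invariant under local unitaries, and non-increasing under local operations and classical communication (in particular non-increasing under local operations and shared randomness, i.e. maps $\sum_w\gamma_w \Lambda_w^A\otimes\Lambda_w^B$ with $\gamma$ a probability distribution and $\Lambda^A_w,\Lambda^B_w$ completely positive trace-preserving). Known fact the setting relies on (Buscemi): for bipartite states $\rho_1,\rho_2$, one has $\mathfrak{p}^*(\rho_1)\ge\mathfrak{p}^*(\rho_2)$ for every semiquantum nonlocal game if and only if $\rho_1$ can be transformed into $\rho_2$ by local operations and shared randomness; in that case $E(\rho_1)\ge E(\rho_2)$. *)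

(* Defs.v *)
From HB Require Import structures.
From mathcomp Require Import all_boot all_order all_algebra.
From mathcomp Require Import all_classical all_reals ereal.
From mathcomp Require Export complex mxtens.

Set Implicit Arguments.
Unset Strict Implicit.
Unset Printing Implicit Defensive.

Import Order.TTheory GRing.Theory Num.Theory.

Local Open Scope classical_set_scope.
Local Open Scope ring_scope.
Local Open Scope complex_scope.
Local Open Scope sesquilinear_scope.

(* A finite-dimensional Hilbert space with a fixed orthonormal basis is
   represented by its dimension n, operators on it by 'M[R[i]]_n, and the
   tensor product of spaces of dimensions a and b by the dimension a * b, with
   the Kronecker product [*t] of mxtens on operators. *)

Section States.
Variable R : realType.
Local Notation C := R[i].

(* [0 <= z] in R[i] says that z is real and nonnegative, so over the complex
   field this condition already forces A to be Hermitian. *)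
Definition psdmx n (A : 'M[C]_n) : Prop :=
  forall v : 'cV[C]_n, 0 <= (v ^t* *m A *m v) ord0 ord0.

Definition is_state n (rho : 'M[C]_n) : Prop := psdmx rho /\ \tr rho = 1.

Definition is_distr (I : finType) (p : I -> R) : Prop :=
  (forall i, 0 <= p i) /\ \sum_i p i = 1.

Definition is_povm (K : finType) n (P : K -> 'M[C]_n) : Prop :=
  (forall k, psdmx (P k)) /\ \sum_k P k = 1%:M.

Definition separable a b (rho : 'M[C]_(a * b)) : Prop :=
  exists (k : nat) (g : 'I_k -> R) (al : 'I_k -> 'M[C]_a) (be : 'I_k -> 'M[C]_b),
    [/\ is_distr g, forall w, is_state (al w), forall w, is_state (be w)
      & rho = \sum_w (g w)%:C *: (al w *t be w)].

(* Partial traces over the left and over the right tensor factor. *)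
Definition ptrace_l m n (M : 'M[C]_(m * n)) : 'M[C]_n :=
  \matrix_(i, j) \sum_(k < m) M (mxtens_index (k, i)) (mxtens_index (k, j)).

Definition ptrace_r m n (M : 'M[C]_(m * n)) : 'M[C]_m :=
  \matrix_(i, j) \sum_(k < n) M (mxtens_index (i, k)) (mxtens_index (j, k)).

End States.

Section Maps.
Variable R : realType.
Local Notation C := R[i].

(* For linear F and G this is the linear map F (x) G, obtained by expanding the
   argument in the matrix units |i><j| (x) |k><l|. *)
Definition tensmap a a' b b' (F : 'M[C]_a -> 'M[C]_a') (G : 'M[C]_b -> 'M[C]_b')
    (X : 'M[C]_(a * b)) : 'M[C]_(a' * b') :=
  \sum_(i < a) \sum_(j < a) \sum_(k < b) \sum_(l < b)
    X (mxtens_index (i, k)) (mxtens_index (j, l))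
      *: (F (delta_mx i j) *t G (delta_mx k l)).

Definition completely_positive a a' (F : 'M[C]_a -> 'M[C]_a') : Prop :=
  linear F /\
  forall (k : nat) (X : 'M[C]_(k * a)),
    psdmx X -> psdmx (tensmap (fun Y : 'M[C]_k => Y) F X).

(* A quantum instrument: completely positive maps, one for each outcome (the
   output space may depend on the outcome), whose sum preserves the trace. *)
Definition is_instrument a k (a1 : 'I_k -> nat)
    (F : forall i : 'I_k, 'M[C]_a -> 'M[C]_(a1 i)) : Prop :=
  (forall i, completely_positive (F i)) /\
  forall X, \sum_i \tr (F i X) = \tr X.

(* Finite-round LOCC channels with output space a' (x) b': in each round one
   party applies a local instrument and announces the outcome i, and the rest of
   the protocol may depend on i.  Shared randomness is the special case where the
   first instrument produces an outcome w by [g w *: Lambda_w^A]. *)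
Inductive locc (a' b' : nat) :
    forall a b : nat, ('M[C]_(a * b) -> 'M[C]_(a' * b')) -> Prop :=
| locc_id : @locc a' b' a' b' (fun X => X)
| locc_alice (a b k : nat) (a1 : 'I_k -> nat)
    (F : forall i : 'I_k, 'M[C]_a -> 'M[C]_(a1 i))
    (L : forall i : 'I_k, 'M[C]_(a1 i * b) -> 'M[C]_(a' * b')) :
    is_instrument F -> (forall i, @locc a' b' (a1 i) b (L i)) ->
    @locc a' b' a b
      (fun X => \sum_i L i (tensmap (F i) (fun Y : 'M[C]_b => Y) X))
| locc_bob (a b k : nat) (b1 : 'I_k -> nat)
    (F : forall i : 'I_k, 'M[C]_b -> 'M[C]_(b1 i))
    (L : forall i : 'I_k, 'M[C]_(a * b1 i) -> 'M[C]_(a' * b')) :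
    is_instrument F -> (forall i, @locc a' b' a (b1 i) (L i)) ->
    @locc a' b' a b
      (fun X => \sum_i L i (tensmap (fun Y : 'M[C]_a => Y) (F i) X)).

(* Only the values of E on states are constrained, or ever used. *)
Record entanglement_measure (E : forall a b : nat, 'M[C]_(a * b) -> R) : Prop :=
  EntanglementMeasure {
    ent_separable : forall a b (rho : 'M[C]_(a * b)), is_state rho ->
      (E a b rho = 0 <-> separable rho);
    ent_unitary : forall a b (U : 'M[C]_a) (V : 'M[C]_b) (rho : 'M[C]_(a * b)),
      is_state rho -> U \is unitarymx -> V \is unitarymx ->
      E a b ((U *t V) *m rho *m (U *t V) ^t*) = E a b rho;
    ent_locc : forall a b a' b' (L : 'M[C]_(a * b) -> 'M[C]_(a' * b'))
        (rho : 'M[C]_(a * b)),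
      locc L -> is_state rho -> E a' b' (L rho) <= E a b rho
  }.

End Maps.

Record sqgame (R : realType) := SQGame {
  gS : finType;
  gT : finType;
  gX : finType;
  gY : finType;
  gp : gS -> R;
  gq : gT -> R;
  qA : nat;
  qB : nat;
  zeta : gS -> 'M[R[i]]_qA;
  eta : gT -> 'M[R[i]]_qB;
  payoff : gS -> gT -> gX -> gY -> R;
  gp_distr : is_distr gp;
  gq_distr : is_distr gq;
  zeta_state : forall s, is_state (zeta s);
  eta_state : forall t, is_state (eta t)
}.

Lemma regroup_dim (a b c d : nat) : (a * (b * c * d) = a * b * (c * d))%N.
Proof. by rewrite !mulnA. Qed.

Section Games.
Variable R : realType.
Local Notation C := R[i].
Variables dA dB : nat.

(* [Z *t (M *t H)] on Q_A (x) ((H_A (x) H_B) (x) Q_B), seen as an operator on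
   (Q_A (x) H_A) (x) (H_B (x) Q_B).  The lexicographic indexing of [*t] is
   associative, so the regrouping is a mere cast of dimensions. *)
Definition tens3 a d (Z : 'M[C]_a) (M : 'M[C]_(dA * dB)) (H : 'M[C]_d) :
    'M[C]_(a * dA * (dB * d)) :=
  castmx (regroup_dim a dA dB d, regroup_dim a dA dB d) (Z *t (M *t H)).

Definition ptrace_ends a d (M : 'M[C]_(a * dA * (dB * d))) : 'M[C]_(dA * dB) :=
  ptrace_r (ptrace_l
    (castmx (esym (regroup_dim a dA dB d), esym (regroup_dim a dA dB d)) M)).

Section Strategy.
Variables (G : sqgame R) (P : gX G -> 'M[C]_(qA G * dA))
  (Q : gY G -> 'M[C]_(dB * qB G)).

Definition outcome_prob (rho : 'M[C]_(dA * dB)) (s : gS G) (t : gT G)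
    (x : gX G) (y : gY G) : R :=
  complex.Re (\tr ((P x *t Q y) *m tens3 (zeta s) rho (eta t))).

Definition avg_payoff (rho : 'M[C]_(dA * dB)) : R :=
  \sum_s \sum_t \sum_x \sum_y
    gp s * gq t * payoff s t x y * outcome_prob rho s t x y.

Definition effective_povm (s : gS G) (t : gT G) (xy : gX G * gY G) :
    'M[C]_(dA * dB) :=
  ptrace_ends ((P xy.1 *t Q xy.2) *m tens3 (zeta s) 1%:M (eta t)).

End Strategy.

(* A set of POVMs on H_A (x) H_B, given as a set of K-labelled POVMs for every
   finite set K of outcomes. *)
Definition povm_set := forall K : finType, set (K -> 'M[C]_(dA * dB)).

Definition pstar (G : sqgame R) (rho : 'M[C]_(dA * dB)) : \bar R :=
  ereal_sup [set v | exists (P : gX G -> 'M[C]_(qA G * dA))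
                            (Q : gY G -> 'M[C]_(dB * qB G)),
    [/\ is_povm P, is_povm Q & v = (avg_payoff P Q rho)%:E]].

Definition qstar (Rset : povm_set) (G : sqgame R) (rho : 'M[C]_(dA * dB)) :
    \bar R :=
  ereal_sup [set v | exists (P : gX G -> 'M[C]_(qA G * dA))
                            (Q : gY G -> 'M[C]_(dB * qB G)),
    [/\ is_povm P, is_povm Q,
        forall s t, Rset (gX G * gY G)%type (effective_povm P Q s t)
      & v = (avg_payoff P Q rho)%:E]].

Definition effective_states (Rset : povm_set) (rho : 'M[C]_(dA * dB)) :
    set 'M[C]_(dA * dB) :=
  [set sigma | is_state sigma /\
     forall G : sqgame R, (qstar Rset G rho <= pstar G sigma)%E].

Definition effective_entanglement (E : forall a b : nat, 'M[C]_(a * b) -> R)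
    (Rset : povm_set) (rho : 'M[C]_(dA * dB)) : \bar R :=
  ereal_inf [set (E dA dB sigma)%:E | sigma in effective_states Rset rho].

End Games.

(* Main.v *)
(** If [pstar G tau <= pstar G sigma] for every game G, then tau is obtained from
    sigma by local operations and shared randomness (Buscemi), hence
    [E tau <= E sigma]; applied to [tau = rhobar] this makes rhobar a minimiser of
    E over the effective states.

    For Buscemi's theorem, write F_P for the channel of a POVM P on Q_A (x) H_A:
    it teleports the state through P, i.e. F_P corrects the outcome x by the
    orthogonal matrix U_x^T, so that the expectation of F_P(Y) in a unit vector v
    is the average over x of [tr (P_x (zeta_(x,v) (x) Y))], where zeta_(x,v) is the
    projector on U_x applied to the complex conjugate of v.  A game whose
    questions are (x,v), v in a finite tomographic family, and which pays only
    when the answer is x, therefore has as payoff an arbitrary linear functional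
    of (F_P (x) F_Q)(rho).  Bell measurements give F_P = F_Q = id, so tau is not
    separated by any functional from the compact set of all
    (F_P (x) F_Q)(sigma), and hence lies in its convex hull. *)

Require Import Defs.
From mathcomp Require Import all_boot all_order all_algebra.
From mathcomp Require Import all_classical all_reals ereal.
From mathcomp Require Import topology normedtype derive.
From mathcomp Require Import ring lra.

Set Implicit Arguments.
Unset Strict Implicit.
Unset Printing Implicit Defensive.

Import Order.TTheory GRing.Theory Num.Theory.
Import numFieldNormedType.Exports.

Local Open Scope classical_set_scope.
Local Open Scope complex_scope.
Local Open Scope ring_scope.
Local Open Scope sesquilinear_scope.

(** * Continuity, closed sets and compactness of the probability simplex *)

Lemma continuous_sum (R : realType) (T : topologicalType) (J : finType)
    (F : J -> T -> R) :
  (forall j, continuous (F j)) -> continuous (fun t => \sum_j F j t).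
Proof.
move=> cF; elim: (index_enum J) => [|j r IH] t.
  by under eq_fun do rewrite big_nil; exact: cvg_cst.
under eq_fun do rewrite big_cons.
exact: cvgD (cF j t) (IH t).
Qed.

Lemma continuous_mul (R : realType) (T : topologicalType) (f g : T -> R) :
  continuous f -> continuous g -> continuous (fun t => f t * g t).
Proof. by move=> cf cg t; exact: cvgM (cf t) (cg t). Qed.

Lemma continuous_sub (R : realType) (T : topologicalType) (f g : T -> R) :
  continuous f -> continuous g -> continuous (fun t => f t - g t).
Proof. by move=> cf cg t; exact: cvgB (cf t) (cg t). Qed.

Lemma continuous_coord (I : eqType) (T U : topologicalType) (i : I)
    (f : T -> U) : continuous f ->
  continuous (fun p : prod_topology (fun _ : I => T) => f (p i)).
Proof.
move=> cf p; apply: (@cvg_comp _ _ _ (fun p : prod_topology _ => p i) f).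
  exact: (@proj_continuous I (fun=> T) i p).
exact: cf.
Qed.

Lemma continuous_fst_comp (T U V : topologicalType) (f : T -> V) :
  continuous f -> continuous (fun p : T * U => f p.1).
Proof.
by move=> cf p; apply: (@cvg_comp _ _ _ fst f _ (nbhs p.1)); [exact: cvg_fst|exact: cf].
Qed.

Lemma continuous_snd_comp (T U V : topologicalType) (f : U -> V) :
  continuous f -> continuous (fun p : T * U => f p.2).
Proof.
by move=> cf p; apply: (@cvg_comp _ _ _ snd f _ (nbhs p.2)); [exact: cvg_snd|exact: cf].
Qed.

Lemma closed_ge0 (R : realType) (T : topologicalType) (f : T -> R) :
  continuous f -> closed [set t | 0 <= f t].
Proof.
move=> cf; apply: (@preimage_closed _ _ f [set r : R | 0 <= r]).
  by move=> t _; exact: cf.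
exact: closed_ge.
Qed.

Lemma closed_eqr (R : realType) (T : topologicalType) (f : T -> R) (c : R) :
  continuous f -> closed [set t | f t = c].
Proof.
move=> cf; apply: (@preimage_closed _ _ f [set r : R | r = c]).
  by move=> t _; exact: cf.
exact: closed_eq.
Qed.

(** Nonnegative weights with sum 1 lie in a power of the unit interval, compact by Tychonoff, and
    the defining conditions are closed. *)
Lemma compact_simplex (R : realType) (I : finType) :
  compact [set g : prod_topology (fun _ : I => R) | is_distr g].
Proof.
have := @tychonoff I (fun _ => R) (fun _ => `[0, 1]%classic) (fun _ => @segment_compact R 0 1).
move=> cub; apply: (subclosed_compact _ cub); last first.
  move=> g [g0 g1] i /=; rewrite in_itv /= g0 /= -g1 (bigD1 i) //= lerDl.
  by rewrite sumr_ge0.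
rewrite [X in closed X](_ : _ = (\bigcap_(i in setT) [set g | 0 <= g i]) `&`
    [set g | \sum_i g i = 1]); last first.
  apply/seteqP; split=> g /= [] => [g0 g1|g0 g1]; first by split=> [i _|] /=.
  by split=> // i; exact: g0.
apply: closedI.
  apply: closed_bigI => i _.
  by apply: closed_ge0 => g; exact: (@proj_continuous I (fun=> R) i g).
apply: closed_eqr; apply: continuous_sum => i g.
exact: (@proj_continuous I (fun=> R) i g).
Qed.

(** * Affine dependence and the Caratheodory reduction *)

Section ConvexHull.
Variables (R : realType) (I : finType).
Implicit Types (u w x y : I -> R).

Definition dotp u w : R := \sum_i u i * w i.

Definition conv_comb k (g : 'I_k -> R) (y : 'I_k -> I -> R) : I -> R :=
  fun i => \sum_j g j * y j i.

(** Appending a coordinate 1 to each [y j] gives [k] vectors in dimension [#|I| + 1], so a nonzero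
    row vector kills them all. The added coordinate makes its entries sum to 0, hence one of them is
    positive. *)
Lemma affine_dependence k (y : 'I_k -> I -> R) : (#|I|.+1 < k)%N ->
  exists c : 'I_k -> R,
    [/\ exists j, 0 < c j, \sum_j c j = 0 & forall i, \sum_j c j * y j i = 0].
Proof.
move=> ltk.
pose A : 'M[R]_(k, #|I| + 1) :=
  row_mx (\matrix_(j, i) y j (enum_val i)) (const_mx 1).
have kerA : kermx A != 0.
  rewrite kermx_eq0 /row_free neq_ltn; apply/orP; left.
  by rewrite (leq_ltn_trans (rank_leq_col A)) // addn1.
have [c cN0 cA] : exists2 c : 'rV[R]_k, c != 0 & c *m A = 0.
  by case/rowV0Pn: kerA => c /sub_kermxP cA cN0; exists c.
have sum0 : \sum_j c 0 j = 0.
  transitivity ((c *m A) 0 (rshift _ 0)); last by rewrite cA mxE.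
  by rewrite mxE; apply: eq_bigr => j _; rewrite row_mxEr mxE mulr1.
have comb0 i : \sum_j c 0 j * y j i = 0.
  transitivity ((c *m A) 0 (lshift _ (enum_rank i))); last by rewrite cA mxE.
  by rewrite mxE; apply: eq_bigr => j _; rewrite row_mxEl mxE enum_rankK.
have [[j cj]|nexj] := pselect (exists j, 0 < c 0 j); first by exists (c 0); split=> //; exists j.
have cle j : 0 <= - c 0 j.
  by rewrite oppr_ge0 leNgt; apply/negP => cj; apply: nexj; exists j.
have c0 : \sum_j - c 0 j = 0 by rewrite sumrN sum0 oppr0.
case/eqP: cN0; apply/rowP => j; rewrite mxE; apply/eqP; rewrite -oppr_eq0.
by move/eqP: c0; rewrite psumr_eq0 // => /allP/(_ j); rewrite mem_index_enum => /(_ isT).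
Qed.

Lemma caratheodory_step k (g : 'I_k.+1 -> R) (y : 'I_k.+1 -> I -> R) :
  (#|I|.+1 < k.+1)%N -> is_distr g ->
  exists h : 'I_k -> R, exists s : 'I_k -> 'I_k.+1, is_distr h /\
    conv_comb h (y \o s) = conv_comb g y.
Proof.
move=> ltk [g0 g1]; have [c [[j0 cj0] sc cy]] := affine_dependence y ltk.
case: (@arg_minP _ R _ j0 (fun j => 0 < c j) (fun j => g j / c j) cj0) => m cm mP.
pose t := g m / c m; pose h j := g j - t * c j.
have t0 : 0 <= t by rewrite divr_ge0 // ltW.
have hm : h m = 0 by rewrite /h /t divfK ?subrr // gt_eqF.
have h0 j : 0 <= h j.
  rewrite /h subr_ge0; case: (ltP 0 (c j)) => cj; first by rewrite -ler_pdivlMr // mP.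
  by rewrite (le_trans _ (g0 j)) // mulr_ge0_le0.
have sumlift (F : 'I_k.+1 -> R) : F m = 0 -> \sum_j F (lift m j) = \sum_j F j.
  by move=> Fm; rewrite [RHS](bigD1_ord m) //= Fm add0r.
exists (h \o lift m), (lift m); split; first split=> [j|] /=; first exact: h0.
  by rewrite sumlift // /h sumrB g1 -mulr_sumr sc mulr0 subr0.
apply/funext => i; rewrite /conv_comb (sumlift (fun j => h j * y j i)) ?hm ?mul0r //.
rewrite (eq_bigr (fun j => g j * y j i - t * (c j * y j i))); last first.
  by move=> j _; rewrite /h mulrBl mulrA.
by rewrite sumrB -mulr_sumr cy mulr0 subr0.
Qed.

End ConvexHull.

(** * Convex hull of the continuous image of a compact set *)

Lemma continuous_sqdist (R : realType) (I : finType) (T : topologicalType)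
    (x : I -> R) (F : T -> I -> R) : (forall i, continuous (F^~ i)) ->
  continuous (fun t => dotp (fun i => x i - F t i) (fun i => x i - F t i)).
Proof.
move=> cF; apply: continuous_sum => i.
have cd : continuous (fun t => x i - F t i).
  by apply: continuous_sub (cF i) => t; exact: cvg_cst.
exact: (continuous_mul cd cd).
Qed.

Section CompactHull.
Variables (R : realType) (I : finType) (T : topologicalType).
Variables (A : set T) (f : T -> I -> R).
Hypothesis A_compact : compact A.
Hypothesis f_continuous : forall i, continuous (fun t => f t i).
Arguments f_continuous : clear implicits.

Lemma continuous_comb k (i : I) :
  continuous (fun p : prod_topology (fun _ : 'I_k => R) * prod_topology (fun _ : 'I_k => T) =>
    conv_comb p.1 (f \o p.2) i).
Proof.
apply: continuous_sum => j.
apply: continuous_mul.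
  exact: (@continuous_fst_comp _ _ _ (fun g : prod_topology (fun _ : 'I_k => R) => g j)
    (@proj_continuous _ (fun=> R) j)).
exact: (@continuous_snd_comp _ _ _ (fun a : prod_topology (fun _ : 'I_k => T) => f (a j) i)
  (continuous_coord (f_continuous i))).
Qed.

(** Squared distance to [x] is continuous in the weights and the points, which range over the
    compact product of a simplex and a power of [A]. *)
Lemma nearest_comb (k : nat) (x : I -> R) : A !=set0 ->
  exists g : 'I_k.+1 -> R, exists a : 'I_k.+1 -> T,
    [/\ is_distr g, forall j, A (a j)
      & forall (h : 'I_k.+1 -> R) (b : 'I_k.+1 -> T),
          is_distr h -> (forall j, A (b j)) ->
          let d y := dotp (fun i => x i - y i) (fun i => x i - y i) in
          d (conv_comb g (f \o a)) <= d (conv_comb h (f \o b))].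
Proof.
move=> [a0 Aa0].
pose G := prod_topology (fun _ : 'I_k.+1 => R).
pose V := prod_topology (fun _ : 'I_k.+1 => T).
pose d (p : G * V) : R :=
  let y := conv_comb p.1 (f \o p.2) in dotp (fun i => x i - y i) (fun i => x i - y i).
have cd : continuous d.
  exact: (@continuous_sqdist R I _ x (fun p : G * V => conv_comb p.1 (f \o p.2))
    (@continuous_comb k.+1)).
have cS := compact_setX (@compact_simplex R 'I_k.+1)
  (@tychonoff 'I_k.+1 (fun _ => T) (fun _ => A) (fun _ => A_compact)).
have [|[g a] /set_mem [/= gd aA] dmin] := compact_EVT_min _ cS (continuous_subspaceT cd).
  exists (fun j => (j == ord0)%:R, fun=> a0); split=> //=.
  split=> [j|]; first exact: ler0n.
  by rewrite (bigD1 ord0) //= big1 ?addr0 // => j /negbTE ->.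
exists g, a; split=> // h b hd bA /=.
by apply: (dmin (h, b)); apply/mem_set; split.
Qed.

(* The nearest combination of #|I|+1 points must be x: otherwise mixing in a
   point beyond the supporting hyperplane gives a closer combination of #|I|+2
   points, which caratheodory_step turns back into one of #|I|+1. *)
Lemma in_conv_compact (x : I -> R) :
  (forall (w : I -> R) c, c < dotp w x -> exists2 a, A a & c < dotp w (f a)) ->
  exists k (g : 'I_k -> R) (a : 'I_k -> T),
    [/\ is_distr g, forall j, A (a j) & conv_comb g (f \o a) = x].
Proof.
move=> sep.
have A0 : A !=set0.
  (* The zero functional exceeds -1 at [x], so the separation hypothesis already yields a point of
     [A]. *)
  have [|a Aa _] := sep (fun=> 0) (-1); last by exists a.
  by rewrite /dotp big1 ?ltrN10 // => i _; rewrite mul0r.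
have [g [a [gd aA gmin]]] := nearest_comb #|I| x A0.
exists #|I|.+1, g, a; split=> //.
set y := conv_comb _ _ in gmin *.
pose w i := x i - y i; pose D := dotp w w.
have [D0|D0] : D = 0 \/ 0 < D.
  have : 0 <= D by apply: sumr_ge0 => i _; rewrite -expr2 sqr_ge0.
  by rewrite le_eqVlt => /orP[/eqP <-|]; [left|right].
  apply/funext => i; apply/esym/eqP; rewrite -subr_eq0.
  move/eqP: D0; rewrite psumr_eq0 => [/allP/(_ i)|j _]; last by rewrite -expr2 sqr_ge0.
  by rewrite mem_index_enum mulf_eq0 orbb; apply.
exfalso.
(* Since [dotp w x - dotp w y = D], the functional [w] is larger at [f b] than at [y] by some
   [s > D / 2]. *)
have [|b Ab ltb] := sep w (dotp w x - D / 2); first by rewrite ltrBlDr ltrDl divr_gt0.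
pose M := dotp (fun i => f b i - y i) (fun i => f b i - y i).
have M0 : 0 <= M by apply: sumr_ge0 => i _; rewrite -expr2 sqr_ge0.
(* Moving from [y] towards [f b] by the fraction [t] turns the squared distance [D] into
   [D - 2 t s + t^2 M], where [2 s > D]. This choice gives [t <= 1] and [t M < D], so the distance
   drops. *)
pose t := D / (D + M).
have DM : 0 < D + M by rewrite ltr_wpDr.
have t0 : 0 < t by rewrite divr_gt0.
have t1 : t <= 1 by rewrite ler_pdivrMr // mul1r lerDl.
pose y' i := (1 - t) * y i + t * f b i.
pose a' (j : 'I_#|I|.+2) := if unlift ord0 j is Some l then a l else b.
pose g' (j : 'I_#|I|.+2) := if unlift ord0 j is Some l then (1 - t) * g l else t.
have g'd : is_distr g'.
  case: (gd) => g0 g1; split=> [j|].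
    rewrite /g'; case: unliftP => [l _|_]; last exact: ltW.
    by rewrite mulr_ge0 ?subr_ge0.
  rewrite big_ord_recl /g' unlift_none (eq_bigr (fun j => (1 - t) * g j)); last first.
    by move=> j _; rewrite liftK.
  by rewrite -mulr_sumr g1 mulr1 addrC subrK.
have y'E : conv_comb g' (f \o a') = y'.
  apply/funext => i; rewrite /conv_comb /= big_ord_recl /g' /a' unlift_none.
  rewrite (eq_bigr (fun j => (1 - t) * (g j * f (a j) i))); last by move=> j _; rewrite liftK mulrA.
  by rewrite -mulr_sumr addrC.
have [h [s [hd hs]]] := caratheodory_step (f \o a') (ltnSn _) g'd.
have := gmin h (a' \o s) hd _; rewrite /= (_ : conv_comb h _ = y'); last by rewrite -y'E -hs.
have a'A j : A (a' (s j)) by rewrite /a'; case: unliftP.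
move/(_ a'A).
apply/negP; rewrite -ltNge -/w -/D.
have wb : D / 2 < dotp w (fun i => f b i - y i).
  have -> : dotp w (fun i => f b i - y i) = dotp w (f b) - dotp w x + D.
    by rewrite /D /dotp -sumrB -big_split /=; apply: eq_bigr => i _; rewrite /w; ring.
  by lra.
have -> : dotp (fun i => x i - y' i) (fun i => x i - y' i)
    = D - t * (2 * dotp w (fun i => f b i - y i)) + t * (t * M).
  rewrite /D /M /dotp !mulr_sumr -sumrB -big_split /=.
  by apply: eq_bigr => i _; rewrite /w /y'; ring.
have tM : t * M < D.
  by rewrite /t mulrAC ltr_pdivrMr // ltr_pM2l // ltrDr.
have : t * (t * M) < t * (2 * dotp w (fun i => f b i - y i)).
  by rewrite ltr_pM2l // (lt_trans tM) // mulrC -ltr_pdivrMr.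
by lra.
Qed.

End CompactHull.

(** * Quadratic forms, positive semidefinite matrices and tomography *)

Section QuadraticForms.
Variable R : realType.
Local Notation C := R[i].

Definition qform n (A : 'M[C]_n) (v : 'cV[C]_n) : C := (v^t* *m A *m v) 0 0.

Lemma qformE n (A : 'M[C]_n) v :
  qform A v = \sum_i \sum_j A i j * ((v i 0)^* * v j 0).
Proof.
rewrite /qform mxE exchange_big /=; apply: eq_bigr => j _.
rewrite mxE mulr_suml; apply: eq_bigr => i _; rewrite !mxE.
by rewrite mulrA [A i j * _]mulrC.
Qed.

Lemma qform_sum n (J : finType) (A : J -> 'M[C]_n) v :
  qform (\sum_j A j) v = \sum_j qform (A j) v.
Proof. by rewrite /qform mulmx_sumr mulmx_suml summxE. Qed.

Lemma qformZ n c (A : 'M[C]_n) v : qform (c *: A) v = c * qform A v.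
Proof. by rewrite /qform -scalemxAr -scalemxAl mxE. Qed.

Lemma qformB n (A B : 'M[C]_n) v : qform (A - B) v = qform A v - qform B v.
Proof. by rewrite /qform mulmxBr mulmxBl !mxE. Qed.

Lemma qform_delta2 n (A : 'M[C]_n) (i j : 'I_n) (c d : C) : i != j ->
  qform A (c *: delta_mx i 0 + d *: delta_mx j 0) =
  c^* * c * A i i + d^* * d * A j j + c^* * d * A i j + d^* * c * A j i.
Proof.
move=> ij; have ji : j != i by rewrite eq_sym.
rewrite qformE; set v := _ + _.
have vE k : v k 0 = c * (k == i)%:R + d * (k == j)%:R by rewrite !mxE !andbT.
have vi : v i 0 = c by rewrite vE eqxx (negbTE ij) mulr1 mulr0 addr0.
have vj : v j 0 = d by rewrite vE eqxx (negbTE ji) mulr1 mulr0 add0r.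
have v0 k : k != i -> k != j -> v k 0 = 0.
  by move=> /negbTE ki /negbTE kj; rewrite vE ki kj !mulr0 addr0.
have row k : \sum_l A k l * ((v k 0)^* * v l 0) =
    A k i * ((v k 0)^* * c) + A k j * ((v k 0)^* * d).
  rewrite (bigD1 i) //= (bigD1 j)  //= vi vj big1 ?addr0 //.
  by move=> l /andP[li lj]; rewrite (v0 l) // !mulr0.
rewrite (bigD1 i) //= row (bigD1 j) //= row big1; first by rewrite vi vj addr0; ring.
by move=> k /andP[ki kj]; rewrite row (v0 k) // conjC0 !mul0r !mulr0 addr0.
Qed.

Lemma qform_delta n (A : 'M[C]_n) (i : 'I_n) : qform A (delta_mx i 0) = A i i.
Proof.
rewrite qformE (bigD1 i) //= (bigD1 i) //= !mxE eqxx conjC1 !mulr1.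
rewrite !big1 ?addr0 // => [k /negbTE ki|k /negbTE ki].
  by rewrite big1 // => l _; rewrite !mxE ki conjC0 mul0r mulr0.
by rewrite !mxE ki !mulr0.
Qed.

Lemma psd_gram m n (B : 'M[C]_(m, n)) : psdmx (B^t* *m B).
Proof.
move=> v; rewrite !mulmxA -mulmxA -[v^t* *m B^t*](_ : (B *m v)^t* = _); last first.
  by rewrite trmx_mul map_mxM.
rewrite mxE sumr_ge0 // => k _; rewrite !mxE mulrC; exact: mul_conjC_ge0.
Qed.

Lemma psd_sum n (J : finType) (A : J -> 'M[C]_n) :
  (forall j, psdmx (A j)) -> psdmx (\sum_j A j).
Proof. by move=> A0 v; rewrite -/(qform _ _) qform_sum sumr_ge0 // => j _; exact: A0. Qed.

Lemma psd_scale n (c : C) (A : 'M[C]_n) : 0 <= c -> psdmx A -> psdmx (c *: A).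
Proof. by move=> c0 A0 v; rewrite -/(qform _ _) qformZ mulr_ge0 //; exact: A0. Qed.

Lemma psd_sandwich m n (K : 'M[C]_(m, n)) (A : 'M[C]_n) :
  psdmx A -> psdmx (K *m A *m K^t*).
Proof.
by move=> A0 v; have := A0 (K^t* *m v); rewrite trmx_mul map_mxM trmxCK !mulmxA.
Qed.

(** Positivity makes every value of the form real. The values at [e_j + c e_i] for [c = 1] and
    [c = 'i] give two linear relations between [A i j], [A j i] and their conjugates, which together
    force conjugate symmetry. *)
Lemma psd_hermitian n (A : 'M[C]_n) : psdmx A -> A^t* = A.
Proof.
move=> A0; apply/matrixP=> i j; rewrite !mxE.
have re v : (qform A v)^* = qform A v by apply: CrealP; apply: ger0_real; exact: A0.
have dre k : (A k k)^* = A k k by rewrite -qform_delta re.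
have [->|ij] := eqVneq i j; first exact: dre.
have key c : c^* * (A j i)^* + c * (A i j)^* = c * A j i + c^* * A i j.
  have := re (1 *: delta_mx j 0 + c *: delta_mx i 0).
  rewrite qform_delta2 1?eq_sym // conjC1 !mul1r !mulr1 => rec.
  apply: (addrI (A j j + c^* * c * A i i)); rewrite addrA [RHS]addrA -rec.
  by rewrite !rmorphD !rmorphM /= !dre !conjCK [c * c^*]mulrC.
have := key 1; rewrite conjC1 !mul1r => e1.
have e2 : (A i j)^* - (A j i)^* = A j i - A i j.
  by apply: (mulfI (neq0Ci C)); have := key 'i; rewrite conjCi !mulNr !mulrBr addrC.
apply: (mulfI (_ : 2 != 0)); first by rewrite pnatr_eq0.
transitivity ((A j i)^* + (A i j)^* - ((A i j)^* - (A j i)^*)); first by ring.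
by rewrite e1 e2; ring.
Qed.

(** By the spectral theorem: the eigenvalues are nonnegative, and [B] is the square root of the
    diagonal matrix times the diagonalising unitary. *)
Lemma psd_gramP n (A : 'M[C]_n) : psdmx A -> exists B : 'M[C]_n, A = B^t* *m B.
Proof.
move=> A0; have Aherm := psd_hermitian A0.
have /orthomx_spectralP : A \is normalmx by apply/normalmxP; rewrite Aherm.
set P := spectralmx A; set d := spectral_diag A => Aeq.
have Pu : P \is unitarymx := spectral_unitarymx A.
rewrite invmx_unitary // in Aeq.
have d0 k : 0 <= d 0 k.
  have := A0 (P^t* *m delta_mx k 0).
  rewrite trmx_mul map_mxM trmxCK -!mulmxA [A *m _]mulmxA.
  have -> : A *m P^t* = P^t* *m diag_mx d.
    by rewrite Aeq -!mulmxA (unitarymxP Pu) mulmx1.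
  rewrite mulmxA -mulmxA [P *m _]mulmxA [P *m _]mulmxA (unitarymxP Pu) mul1mx mulmxA.
  by rewrite -/(qform _ _) qform_delta !mxE eqxx mulr1n.
exists (diag_mx (\row_k sqrtC (d 0 k)) *m P).
rewrite trmx_mul map_mxM !mulmxA.
rewrite -[P^t* *m _ *m _]mulmxA [_ *m diag_mx _](_ : _ = diag_mx d) //.
rewrite tr_diag_mx map_diag_mx mulmx_diag; congr diag_mx; apply/rowP=> k.
by rewrite !mxE /= geC0_conj ?sqrtC_ge0 // -expr2 sqrtCK.
Qed.

(** For a Gram matrix the bound follows termwise from [x y <= x^2 + y^2]. It serves to bound the
    entries of POVM elements. *)
Lemma psd_entry_bound n (A : 'M[C]_n) i j : psdmx A ->
  `|A i j| <= A i i + A j j.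
Proof.
move=> /psd_gramP[B ->]; rewrite !mxE.
apply: (le_trans (ler_norm_sum _ _ _)); rewrite -big_split /=.
apply: ler_sum => k _; rewrite !mxE /= normrM norm_conjC.
rewrite ![_^* * _]mulrC -!normCK.
set x := `|_|; set y := `|_|.
have x0 : 0 <= x := normr_ge0 _; have y0 : 0 <= y := normr_ge0 _.
have xyr : x - y \is Num.real by rewrite rpredB ?ger0_real.
have: 0 <= (x - y) ^+ 2 + x ^+ 2 + y ^+ 2.
  apply: addr_ge0; last exact: exprn_ge0.
  by apply: addr_ge0; [exact: real_exprn_even_ge0|exact: exprn_ge0].
rewrite (_ : _ + _ + _ = 2 * (x ^+ 2 + y ^+ 2 - x * y)); last by ring.
by rewrite pmulr_rge0 ?ltr0n // subr_ge0.
Qed.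

Lemma psd_ge0_diag n (A : 'M[C]_n) i : psdmx A -> 0 <= A i i.
Proof. by move=> /(_ (delta_mx i 0)); rewrite -/(qform _ _) qform_delta. Qed.

(* 3/5 and 4/5 make these unit vectors without square roots. *)
Definition tomo_vec n (s : 'I_n * 'I_n * bool) : 'cV[C]_n :=
  let: (i, j, b) := s in
  if i == j then delta_mx i 0
  else (3 / 5) *: delta_mx i 0 + (4 / 5 * 'i ^+ b) *: delta_mx j 0.

Lemma conj_ratio (p q : nat) : ((p%:R / q%:R : C))^* = p%:R / q%:R.
Proof. by rewrite rmorphM fmorphV /= !conjC_nat. Qed.

Lemma tomo_vec_unit n (s : 'I_n * 'I_n * bool) :
  (tomo_vec s)^t* *m tomo_vec s = 1%:M.
Proof.
apply/matrixP => a b; rewrite !ord1 -[_^t* in LHS]mulmx1 -/(qform _ _) !mxE eqxx.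
case: s => [[i j] e] /=; case: eqVneq => [ij|ij].
  by rewrite qform_delta mxE eqxx.
rewrite qform_delta2 // !mxE !eqxx (negbTE ij) eq_sym (negbTE ij) !mulr0 !addr0 !mulr1.
rewrite !conj_ratio rmorphM /= !conj_ratio rmorphXn /= conjCi.
have ii : (- 'i) ^+ e * 'i ^+ e = 1 :> C.
  by rewrite -exprMn mulNr -expr2 sqrCi opprK expr1n.
transitivity (3 / 5 * (3 / 5) + 4 / 5 * (4 / 5) * ((- 'i) ^+ e * 'i ^+ e) : C).
  by ring.
rewrite ii mulr1.
have n5 : (5 : C) != 0 by rewrite pnatr_eq0.
by rewrite -!mulrA; field.
Qed.

(** Polarisation: the vectors with [i = j] give the diagonal, and for distinct [i], [j] the phases 1
    and ['i] give [A i j + A j i = 0] and [A i j - A j i = 0]. *)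
Lemma tomography n (A : 'M[C]_n) :
  (forall s, qform A (tomo_vec s) = 0) -> A = 0.
Proof.
move=> A0.
have D i : A i i = 0 by have := A0 (i, i, true); rewrite /= eqxx qform_delta.
apply/matrixP => i j; rewrite mxE; have [->|ij] := eqVneq i j; first exact: D.
have key e : 'i ^+ (e : bool) * A i j + (- 'i) ^+ e * A j i = 0.
  have := A0 (i, j, e); rewrite /= (negbTE ij) qform_delta2 // !D !mulr0 !add0r.
  rewrite !conj_ratio rmorphM /= !conj_ratio rmorphXn /= conjCi => h.
  have n5 : (5 : C) != 0 by rewrite pnatr_eq0.
  have n12 : (3 / 5 * (4 / 5) : C) != 0 by rewrite !mulf_neq0 ?invr_eq0 ?pnatr_eq0.
  apply: (mulfI n12); rewrite mulr0 -h; ring.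
have := key false; have := key true; rewrite !expr1 !expr0 !mul1r mulNr => /eqP.
rewrite subr_eq0 => /eqP/(mulfI (neq0Ci C)) <- /eqP.
by rewrite -mulr2n mulrn_eq0 => /eqP.
Qed.

End QuadraticForms.

(** * Tensor products of matrices and of linear maps *)

Section Tensors.
Variable R : realType.
Local Notation C := R[i].

Lemma sum_mxtens (V : nmodType) a b (F : 'I_(a * b) -> V) :
  \sum_p F p = \sum_i \sum_k F (mxtens_index (i, k)).
Proof.
rewrite pair_big /= (reindex (@mxtens_index a b)) /=.
  by apply: eq_bigr => -[].
by exists (@mxtens_unindex a b) => p _; rewrite (mxtens_indexK, mxtens_unindexK).
Qed.

Lemma qform_tens a b (M : 'M[C]_(a * b)) (v : 'cV_a) (w : 'cV_b) :
  qform M (v *t w) = \sum_i \sum_j \sum_k \sum_l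
    M (mxtens_index (i, k)) (mxtens_index (j, l))
      * ((v i 0)^* * v j 0) * ((w k 0)^* * w l 0).
Proof.
rewrite qformE sum_mxtens; apply: eq_bigr => i _.
rewrite [RHS]exchange_big /=; apply: eq_bigr => k _; rewrite sum_mxtens.
apply: eq_bigr => j _; apply: eq_bigr => l _.
rewrite -mulrA; congr (_ * _); rewrite !mxE !mxtens_indexK !ord1 rmorphM /=.
by rewrite mulrACA.
Qed.

(** Fixing the second test vector contracts [M] to a matrix on the first factor, which vanishes by
    tomography; each block of [M] on the second factor then vanishes for the same reason. *)
Lemma tomography_tens a b (M : 'M[C]_(a * b)) :
  (forall s t, qform M (tomo_vec R s *t tomo_vec R t) = 0) -> M = 0.
Proof.
move=> M0.
pose N t : 'M[C]_a := \matrix_(i, j) \sum_k \sum_l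
  M (mxtens_index (i, k)) (mxtens_index (j, l))
    * ((tomo_vec R t k 0)^* * tomo_vec R t l 0).
have N0 t : N t = 0.
  apply: tomography => s; rewrite -(M0 s t) qform_tens qformE.
  apply: eq_bigr => i _; apply: eq_bigr => j _; rewrite mxE mulr_suml.
  apply: eq_bigr => k _; rewrite mulr_suml; apply: eq_bigr => l _; ring.
pose B i j : 'M[C]_b := \matrix_(k, l) M (mxtens_index (i, k)) (mxtens_index (j, l)).
have B0 i j : B i j = 0.
  apply: tomography => t; rewrite qformE.
  transitivity (N t i j); last by rewrite N0 mxE.
  by rewrite mxE; apply: eq_bigr => k _; apply: eq_bigr => l _; rewrite mxE.
apply/matrixP => p q; case: (mxtens_indexP p) => i k; case: (mxtens_indexP q) => j l.
transitivity (B i j k l); first by rewrite mxE.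
by rewrite B0 !mxE.
Qed.

Lemma tens_sum_delta a b (X : 'M[C]_(a * b)) :
  X = \sum_i \sum_j \sum_k \sum_l X (mxtens_index (i, k)) (mxtens_index (j, l))
        *: (delta_mx i j *t delta_mx k l).
Proof.
rewrite {1}(matrix_sum_delta X) sum_mxtens; apply: eq_bigr => i _.
under eq_bigr do rewrite sum_mxtens.
rewrite exchange_big /=; apply: eq_bigr => j _; apply: eq_bigr => k _.
apply: eq_bigr => l _; congr (_ *: _); apply/matrixP => p q.
case: (mxtens_indexP p) => i' k'; case: (mxtens_indexP q) => j' l'.
rewrite tensmxE !mxE -!(inj_eq (can_inj (@mxtens_unindexK a b))) !mxtens_indexK !xpair_eqE.
by rewrite -natrM mulnb andbACA.
Qed.

Lemma linear_sumZ (U V : lmodType C) (F : U -> V) (J : finType) (c : J -> C)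
    (x : J -> U) : linear F -> F (\sum_j c j *: x j) = \sum_j c j *: F (x j).
Proof.
move=> linF; have F0 : F 0 = 0.
  by have := linF (-1) 0 0; rewrite scaler0 addr0 scaleN1r addNr.
by elim/big_rec2: _ => // j y z _ <-; rewrite linF.
Qed.

Lemma tensmx_is_linear m n p q (A : 'M[C]_(m, n)) :
  linear (fun B : 'M[C]_(p, q) => A *t B).
Proof. by move=> c B D; apply/matrixP => i j; rewrite !mxE; ring. Qed.

Lemma tensmx_is_linearl m n p q (B : 'M[C]_(p, q)) :
  linear (fun A : 'M[C]_(m, n) => A *t B).
Proof. by move=> c A D; apply/matrixP => i j; rewrite !mxE; ring. Qed.

Lemma tens_suml (J : finType) m n p q (A : J -> 'M[C]_(m, n)) (B : 'M[C]_(p, q)) :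
  (\sum_j A j) *t B = \sum_j A j *t B.
Proof.
apply/matrixP => i j; rewrite mxE !summxE mulr_suml.
by apply: eq_bigr => k _; rewrite mxE.
Qed.

Lemma tens_sumr (J : finType) m n p q (A : 'M[C]_(m, n)) (B : J -> 'M[C]_(p, q)) :
  A *t (\sum_j B j) = \sum_j A *t B j.
Proof.
apply/matrixP => i j; rewrite mxE !summxE mulr_sumr.
by apply: eq_bigr => k _; rewrite mxE.
Qed.

(** Products of matrix units span the space. This is the tool for recognising a concrete linear map
    as a [tensmap]. *)
Lemma tensmap_unique a a' b b' (F : 'M[C]_a -> 'M[C]_a')
    (G : 'M[C]_b -> 'M[C]_b') (H : 'M[C]_(a * b) -> 'M[C]_(a' * b')) :
  linear H ->
  (forall i j k l, H (delta_mx i j *t delta_mx k l) =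
     F (delta_mx i j) *t G (delta_mx k l)) ->
  forall X, H X = tensmap F G X.
Proof.
move=> linH HE X; rewrite {1}(tens_sum_delta X) /tensmap.
have sumH (J : finType) (x : J -> 'M[C]_(a * b)) : H (\sum_j x j) = \sum_j H (x j).
  have := linear_sumZ (fun=> 1) x linH.
  by rewrite (eq_bigr x) => [->|j _]; rewrite ?scale1r //; apply: eq_bigr => j _; rewrite scale1r.
do 3![rewrite sumH; apply: eq_bigr => ? _].
by rewrite (linear_sumZ _ _ linH); apply: eq_bigr => l _; rewrite HE.
Qed.

Lemma tensmap_tens a a' b b' (F : 'M[C]_a -> 'M[C]_a')
    (G : 'M[C]_b -> 'M[C]_b') (A : 'M[C]_a) (B : 'M[C]_b) :
  linear F -> linear G -> tensmap F G (A *t B) = F A *t G B.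
Proof.
move=> linF linG.
have FA : F A = \sum_i \sum_j A i j *: F (delta_mx i j).
  rewrite {1}(matrix_sum_delta A) pair_big /= (linear_sumZ _ _ linF).
  by rewrite pair_big.
have GB : G B = \sum_i \sum_j B i j *: G (delta_mx i j).
  rewrite {1}(matrix_sum_delta B) pair_big /= (linear_sumZ _ _ linG).
  by rewrite pair_big.
rewrite FA GB !pair_big /= (linear_sumZ _ _ (tensmx_is_linearl _)).
rewrite /tensmap pair_big /=; apply: eq_bigr => -[i j] _ /=.
rewrite (linear_sumZ _ _ (tensmx_is_linear _)) scaler_sumr pair_big /=.
by apply: eq_bigr => -[k l] _ /=; rewrite tensmxE scalerA.
Qed.

Lemma tensmap_linear a a' b b' (F : 'M[C]_a -> 'M[C]_a') (G : 'M[C]_b -> 'M[C]_b') :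
  linear (tensmap F G).
Proof.
move=> c X Y; rewrite /tensmap scaler_sumr -big_split; apply: eq_bigr => i _ /=.
rewrite scaler_sumr -big_split; apply: eq_bigr => j _ /=.
rewrite scaler_sumr -big_split; apply: eq_bigr => k _ /=.
rewrite scaler_sumr -big_split; apply: eq_bigr => l _ /=.
by rewrite !mxE scalerDl scalerA.
Qed.

Lemma tensmap_comp a a' b b' (F : 'M[C]_a -> 'M[C]_a') (G : 'M[C]_b -> 'M[C]_b') X :
  linear F -> linear G ->
  tensmap (fun Y => Y) G (tensmap F (fun Y => Y) X) = tensmap F G X.
Proof.
move=> linF linG.
apply: (@tensmap_unique _ _ _ _ F G (fun X => tensmap (fun Y => Y) G (tensmap F (fun Y => Y) X))).
  by move=> c Y Z; rewrite !tensmap_linear.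
by move=> i j k l; rewrite !tensmap_tens.
Qed.

(** * Kraus maps, channels, and shared randomness as an LOCC protocol *)

Definition kraus (J : finType) m n (K : J -> 'M[C]_(m, n)) (X : 'M[C]_n) : 'M[C]_m :=
  \sum_j K j *m X *m (K j)^t*.

Lemma kraus_linear (J : finType) m n (K : J -> 'M[C]_(m, n)) : linear (kraus K).
Proof.
move=> c X Y; rewrite /kraus scaler_sumr -big_split; apply: eq_bigr => j _ /=.
by rewrite mulmxDr mulmxDl -scalemxAr -scalemxAl.
Qed.

Lemma tensmap_kraus (J L : finType) a a' b b' (K : J -> 'M[C]_(a', a))
    (K' : L -> 'M[C]_(b', b)) X :
  tensmap (kraus K) (kraus K') X = kraus (fun p : J * L => K p.1 *t K' p.2) X.
Proof.
apply/esym; apply: tensmap_unique; first exact: kraus_linear.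
move=> i j k l; rewrite /kraus.
rewrite tens_suml -(pair_big xpredT xpredT (fun p q =>
  (K p *t K' q) *m (delta_mx i j *t delta_mx k l) *m (K p *t K' q)^t*)) /=.
apply: eq_bigr => p _; rewrite tens_sumr; apply: eq_bigr => q _.
by rewrite trmx_tens map_mxT !tensmx_mul.
Qed.

Lemma psd_kraus (J : finType) m n (K : J -> 'M[C]_(m, n)) X :
  psdmx X -> psdmx (kraus K X).
Proof. by move=> X0; apply: psd_sum => j; exact: psd_sandwich. Qed.

Lemma kraus_id n : kraus (fun _ : 'I_1 => 1%:M : 'M[C]_n) = id.
Proof. by apply/funext => X; rewrite /kraus big_ord1 mul1mx trmx1 map_mx1 mulmx1. Qed.

(** The identity on the ancilla is itself a Kraus map, so the extended map is again in Kraus form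
    and preserves positivity. *)
Lemma kraus_cp (J : finType) m n (K : J -> 'M[C]_(m, n)) : completely_positive (kraus K).
Proof.
split=> [|k X X0]; first exact: kraus_linear.
by rewrite -[fun Y => Y](kraus_id k) tensmap_kraus; exact: psd_kraus.
Qed.

Lemma kraus_trace (J : finType) m n (K : J -> 'M[C]_(m, n)) X :
  \sum_j (K j)^t* *m K j = 1%:M -> \tr (kraus K X) = \tr X.
Proof.
move=> K1; rewrite /kraus raddf_sum /= -[in RHS](mul1mx X) -K1 mulmx_suml raddf_sum /=.
by apply: eq_bigr => j _; rewrite mxtrace_mulC mulmxA.
Qed.

Definition channel m n (F : 'M[C]_n -> 'M[C]_m) :=
  completely_positive F /\ forall X, \tr (F X) = \tr X.

(** Alice's instrument consists of the maps [F w] weighted by [g w], so its announced outcome [w]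
    serves as the shared random variable; Bob answers with [G w], an instrument with a single
    outcome. *)
Lemma locc_shared a b a' b' k (g : 'I_k -> R)
    (F : 'I_k -> 'M[C]_a -> 'M[C]_a') (G : 'I_k -> 'M[C]_b -> 'M[C]_b') :
  is_distr g -> (forall w, channel (F w)) -> (forall w, channel (G w)) ->
  exists2 L : 'M[C]_(a * b) -> 'M[C]_(a' * b'), locc L &
    forall X, L X = \sum_w (g w)%:C *: tensmap (F w) (G w) X.
Proof.
move=> [g0 g1] chF chG.
pose gF (w : 'I_k) X := (g w)%:C *: F w X.
have tensgF c d (H : 'M[C]_c -> 'M[C]_d) w X : tensmap H (gF w) X = (g w)%:C *: tensmap H (F w) X.
  do 4![rewrite scaler_sumr; apply: eq_bigr => ? _].
  by rewrite scalerA mulrC -scalerA; congr (_ *: _); apply/matrixP => i j; rewrite !mxE mulrCA.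
have linF w : linear (F w) by case: (chF w) => -[].
have linG w : linear (G w) by case: (chG w) => -[].
have lingF w : linear (gF w).
  by move=> c X Y; rewrite /gF linF scalerDr !scalerA [c * _]mulrC.
have iF : is_instrument gF.
  split=> [w|X].
    split=> // n X X0; rewrite tensgF; apply: psd_scale; first by rewrite lecR g0.
    by case: (chF w) => -[_ /(_ n X X0)].
  rewrite (eq_bigr (fun w => (g w)%:C * \tr X)); last by move=> w _; rewrite mxtraceZ (chF w).2.
  by rewrite -mulr_suml -rmorph_sum g1 mul1r.
have iG w : is_instrument (fun _ : 'I_1 => G w).
  split=> [_|X]; first by case: (chG w).
  by rewrite big_ord1 (chG w).2.
exists (fun X => \sum_w \sum_(i < 1) tensmap (fun Y => Y) (G w) (tensmap (gF w) (fun Y => Y) X)).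
  apply: (locc_alice (L := fun w Y => \sum_(i < 1) tensmap (fun Z => Z) (G w) Y) iF) => w.
  apply: (locc_bob (L := fun _ Y => Y) (iG w)) => _.
  exact: locc_id.
move=> X; apply: eq_bigr => w _; rewrite big_ord1 tensmap_comp //.
do 4![rewrite scaler_sumr; apply: eq_bigr => ? _].
by rewrite scalerA mulrC -scalerA; congr (_ *: _); apply/matrixP => i j; rewrite !mxE mulrA.
Qed.

End Tensors.

(** * Teleportation through an arbitrary POVM *)

Section Teleportation.
Variable R : realType.
Local Notation C := R[i].

Lemma trmxCZ m n (c : C) (A : 'M[C]_(m, n)) : (c *: A)^t* = c^* *: A^t*.
Proof. by apply/matrixP => i j; rewrite !mxE rmorphM. Qed.

(** This is [B *m (u *t 1%:M)], with the column dimension [1 * e] read as [e]. *)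
Definition contract m d e (B : 'M[C]_(m, d * e)) (u : 'cV[C]_d) : 'M[C]_(m, e) :=
  \matrix_(r, b) \sum_a B r (mxtens_index (a, b)) * u a 0.

(** Factor the product operator through [u *t 1%:M] and use cyclicity of the trace. The probability
    of a measurement outcome thereby becomes the trace of a Kraus term in [Y]. *)
Lemma tr_gram_tens m d e (B : 'M[C]_(m, d * e)) (u : 'cV[C]_d) (Y : 'M[C]_e) :
  \tr (B^t* *m B *m ((u *m u^t*) *t Y)) =
  \tr (contract B u *m Y *m (contract B u)^t*).
Proof.
pose D : 'M[C]_(d * e, 1 * e) := u *t 1%:M.
have -> : (u *m u^t*) *t Y = D *m (1%:M *t Y) *m D^t*.
  by rewrite trmx_tens map_mxT !tensmx_mul trmx1 map_mx1 mulmx1 mul1mx mulmx1.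
have DE r b : (B *m D) r (mxtens_index (0, b)) = contract B u r b.
  rewrite !mxE sum_mxtens; apply: eq_bigr => a _.
  rewrite (bigD1 b) //= big1 => [|k /negbTE kb]; rewrite tensmxE !mxE.
    by rewrite eqxx mulr1 addr0.
  by rewrite kb !mulr0.
rewrite -!mulmxA mxtrace_mulC !mulmxA -[_ *m D^t* *m B^t*]mulmxA.
rewrite (_ : D^t* *m B^t* = (B *m D)^t*); last by rewrite trmx_mul map_mxM.
apply: eq_bigr => r _; rewrite mxE sum_mxtens big_ord1 [RHS]mxE; apply: eq_bigr => b _.
congr (_ * _); last by rewrite 2!mxE DE 2![in RHS]mxE.
rewrite mxE sum_mxtens big_ord1 [RHS]mxE; apply: eq_bigr => k _.
by rewrite DE tensmxE [1%:M _ _]mxE eqxx mul1r.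
Qed.

Lemma unit_state n (u : 'cV[C]_n) : u^t* *m u = 1%:M -> is_state (u *m u^t*).
Proof.
move=> u1; split; first by rewrite -{1}(trmxCK u); exact: psd_gram.
by rewrite mxtrace_mulC u1 mxtrace1.
Qed.

(** Exchange of the two tensor factors: Bob's question register stands on the right and Alice's on
    the left, so results for Alice are carried over to Bob. *)
Definition mxswap m a n b (M : 'M[C]_(m * a, n * b)) : 'M[C]_(a * m, b * n) :=
  \matrix_(p, q) M (mxtens_index ((mxtens_unindex p).2, (mxtens_unindex p).1))
                   (mxtens_index ((mxtens_unindex q).2, (mxtens_unindex q).1)).

Lemma mxswapE m a n b (M : 'M[C]_(m * a, n * b)) i j k l :
  mxswap M (mxtens_index (i, j)) (mxtens_index (k, l)) =
  M (mxtens_index (j, i)) (mxtens_index (l, k)).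
Proof. by rewrite mxE !mxtens_indexK. Qed.

Lemma mxswap_tens m a n b (M : 'M[C]_(m, n)) (A : 'M[C]_(a, b)) :
  mxswap (M *t A) = A *t M.
Proof.
apply/matrixP => p q; case: (mxtens_indexP p) => i j; case: (mxtens_indexP q) => k l.
by rewrite mxswapE !tensmxE mulrC.
Qed.

Lemma mxswap_mul m a n b p c (M : 'M[C]_(m * a, n * b)) (L : 'M[C]_(n * b, p * c)) :
  mxswap (M *m L) = mxswap M *m mxswap L.
Proof.
apply/matrixP => x y; case: (mxtens_indexP x) => i j; case: (mxtens_indexP y) => k l.
rewrite mxswapE !mxE !sum_mxtens exchange_big; apply: eq_bigr => s _.
by apply: eq_bigr => t _; rewrite !mxswapE.
Qed.

Lemma mxswap_trmxC m a n b (M : 'M[C]_(m * a, n * b)) : (mxswap M)^t* = mxswap (M^t*).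
Proof. by apply/matrixP => x y; rewrite !mxE. Qed.

Lemma mxswap1 m a : mxswap (1%:M : 'M[C]_(m * a)) = 1%:M.
Proof.
apply/matrixP => x y; case: (mxtens_indexP x) => i j; case: (mxtens_indexP y) => k l.
rewrite mxswapE !mxE !(inj_eq (can_inj (@mxtens_indexK _ _))) !xpair_eqE.
by rewrite andbC.
Qed.

Lemma mxtrace_swap m a (M : 'M[C]_(m * a)) : \tr (mxswap M) = \tr M.
Proof.
rewrite /mxtrace !sum_mxtens exchange_big.
by apply: eq_bigr => i _; apply: eq_bigr => j _; rewrite mxswapE.
Qed.

Lemma psd_mxswap m a (M : 'M[C]_(m * a)) : psdmx M -> psdmx (mxswap M).
Proof. by move=> /psd_gramP[B ->]; rewrite mxswap_mul -mxswap_trmxC; exact: psd_gram. Qed.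

Lemma povm_mxswap (K : finType) m a (P : K -> 'M[C]_(m * a)) :
  is_povm P -> is_povm (fun k => mxswap (P k)).
Proof.
move=> [P0 P1]; split=> [k|]; first exact: psd_mxswap.
rewrite -mxswap1 -P1; apply/matrixP => x y; rewrite !mxE !summxE.
by apply: eq_bigr => k _; rewrite mxE.
Qed.

(* A family of orthogonal matrices over which conjugation averages every
   operator to a multiple of the identity. *)
Definition design (X : finType) d (U : X -> 'M[C]_d) (N : C) :=
  [/\ 0 < N, forall x, (U x)^t* = (U x)^T, forall x, U x *m (U x)^T = 1%:M
    & forall a b c e, \sum_x U x a b * U x c e = N * ((a == c) && (b == e))%:R].

Lemma design_exists n :
  exists (X : finType) (U : X -> 'M[C]_n.+1) (N : C), design U N.
Proof.
(* Products of cyclic shifts and diagonal sign matrices. *)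
pose X := ('I_n.+1 * {ffun 'I_n.+1 -> bool})%type.
pose U (x : X) : 'M[C]_n.+1 :=
  \matrix_(a, b) ((a == b + x.1)%:R * (-1) ^+ x.2 b).
exists X, U, #|{ffun 'I_n.+1 -> bool}|%:R; split.
- by rewrite ltr0n; apply/card_gt0P; exists [ffun=> true].
- move=> x; apply/matrixP => a b; rewrite !mxE /= rmorphM rmorph_nat rmorphXn /=.
  by rewrite rmorphN rmorph1.
- move=> x; apply/matrixP => a c; rewrite !mxE (bigD1 (a - x.1)) //= !mxE subrK eqxx.
  rewrite big1 => [|b ba]; last first.
    by rewrite !mxE -subr_eq eq_sym (negbTE ba) !mul0r.
  by rewrite mul1r addr0 mulrCA -expr2 sqrr_sign mulr1 eq_sym.
move=> a b c e.
rewrite -(pair_big xpredT xpredT (fun k (s : {ffun 'I_n.+1 -> bool}) =>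
  U (k, s) a b * U (k, s) c e)) /=.
(* Only the shift by [a - b] has a nonzero entry at [(a, b)]. *)
rewrite (bigD1 (a - b)) //= [X in _ + X]big1 ?addr0 => [|k kab]; last first.
  rewrite big1 // => s _; rewrite !mxE /= (_ : a == b + k = false) ?mul0r //.
  by apply: contraNF kab => /eqP ->; rewrite addrC addKr.
have [->|be] := eqVneq b e; last first.
  rewrite andbF mulr0 /=.
  (* Flipping the sign at [b] alone is an involution that negates every term, so the sum equals its
     own opposite. *)
  pose flip (s : {ffun 'I_n.+1 -> bool}) := [ffun i => if i == b then ~~ s i else s i].
  have flipK : involutive flip.
    by move=> s; apply/ffunP => i; rewrite !ffunE; case: eqP => // _; rewrite negbK.
  set S := \sum_s _.
  have SN : S = - S.
    rewrite {1}/S (reindex_inj (inv_inj flipK)) -sumrN; apply: eq_bigr => s _.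
    rewrite !mxE /= !ffunE eqxx (eq_sym e) (negbTE be).
    by rewrite signrN; ring.
  have /eqP : S *+ 2 = 0 by rewrite mulr2n {1}SN addNr.
  by rewrite mulrn_eq0 => /eqP.
rewrite andbT (eq_bigr (fun=> (a == c)%:R)) => [|s _].
  by rewrite sumr_const mulr_natl.
rewrite !mxE /= addrC subrK eqxx mul1r mulrCA mulrA -mulrA -expr2 sqrr_sign.
by rewrite mulr1 eq_sym.
Qed.

Section Design.
Variables (X : finType) (d : nat) (U : X -> 'M[C]_d) (N : C).
Hypotheses (U_design : design U N) (d_gt0 : (0 < d)%N).

Definition question_vec x (v : 'cV[C]_d) : 'cV[C]_d := U x *m map_mx Num.conj v.

Definition question x v : 'M[C]_d := question_vec x v *m (question_vec x v)^t*.

Lemma design_real x a b : (U x a b)^* = U x a b.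
Proof. by have [_ /(_ x)/matrixP/(_ b a)+ _ _] := U_design; rewrite !mxE. Qed.

Lemma question_state x v : v^t* *m v = 1%:M -> is_state (question x v).
Proof.
have [_ /(_ x) Ureal /(_ x) U1 _] := U_design.
move=> v1; apply: unit_state; rewrite /question_vec trmx_mul map_mxM Ureal.
rewrite mulmxA -[_ *m _^T *m _]mulmxA (mulmx1C U1) mulmx1.
by rewrite map_trmx -map_mxM v1 map_mx1.
Qed.

(** Count a diagonal entry of the sum of all [U x *m (U x)^T] twice: orthogonality gives 1 for each
    [x], the design property gives [N] for each of the [d] columns. *)
Lemma card_design : #|X|%:R = d%:R * N.
Proof.
have [_ _ U1 Udes] := U_design.
have a0 : 'I_d := Ordinal d_gt0.
transitivity (\sum_x (U x *m (U x)^T) a0 a0).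
  by rewrite (eq_bigr (fun=> 1)) ?sumr_const // => x _; rewrite U1 mxE eqxx.
under eq_bigr do rewrite mxE.
rewrite exchange_big /= (eq_bigr (fun=> N)).
  by rewrite sumr_const card_ord mulr_natl.
move=> b _; have := Udes a0 b a0 b; rewrite !eqxx mulr1 => <-.
by apply: eq_bigr => x _; rewrite mxE.
Qed.

(** The elements are rank one, along the matrices [U x] flattened to vectors and scaled by
    [N^(-1/2)]; the design property is exactly their completeness. Every outcome contributes the
    same amount, and the factors cancel by [card_design]. *)
Lemma bell_povm : exists2 P : X -> 'M[C]_(d * d), is_povm P &
  forall v Y, d%:R^-1 * (\sum_x \tr (P x *m (question x v *t Y))) = qform Y v.
Proof.
have [N0 Ureal U1 Udes] := U_design.
pose k := sqrtC N^-1; have k2 : k * k = N^-1 by rewrite -expr2 sqrtCK.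
have kr : k^* = k by rewrite geC0_conj // sqrtC_ge0 invr_ge0 ltW.
pose B x : 'rV[C]_(d * d) := \row_p (k * U x (mxtens_unindex p).1 (mxtens_unindex p).2).
exists (fun x => (B x)^t* *m B x).
  split=> [x|]; first exact: psd_gram.
  apply/matrixP => p q; case: (mxtens_indexP p) => a b; case: (mxtens_indexP q) => c e.
  rewrite summxE !mxE (inj_eq (can_inj (@mxtens_indexK _ _))) xpair_eqE.
  transitivity (N^-1 * \sum_x U x a b * U x c e).
    rewrite mulr_sumr; apply: eq_bigr => x _; rewrite !mxE big_ord1 !mxE !mxtens_indexK /=.
    by rewrite rmorphM /= kr design_real -k2; ring.
  by rewrite Udes mulKf // gt_eqF.
move=> v Y; rewrite (eq_bigr (fun=> N^-1 * qform Y v)) => [|x _].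
  transitivity (d%:R^-1 * (#|X|%:R * (N^-1 * qform Y v))); first by rewrite sumr_const mulr_natl.
  rewrite card_design -mulrA mulVKf ?gt_eqF // mulKf // pnatr_eq0 -lt0n.
  exact: d_gt0.
rewrite tr_gram_tens.
(* The transpose of [U x] undoes the rotation of the question, and the conjugate in [question_vec]
   is what leaves the adjoint of [v] here. *)
have -> : contract (B x) (question_vec x v) = k *: v^t*.
  apply/rowP => b; rewrite !mxE.
  transitivity (k * ((U x)^T *m question_vec x v) b 0).
    rewrite mxE mulr_sumr; apply: eq_bigr => a _.
    by rewrite !mxE !mxtens_indexK mulrA.
  by rewrite mulmxA (mulmx1C (U1 x)) mul1mx mxE.
rewrite trmxCZ kr trmxCK -!scalemxAl -scalemxAr scalerA k2 mxtraceZ.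
by rewrite /mxtrace big_ord1.
Qed.

(** With [B x] a Gram root of [P x] and [M x r] its row [r] reshaped to a square matrix, the Kraus
    operators are [d^(-1/2)] times [(U x)^T *m M x r]. Their completeness is the left partial trace
    of the POVM condition, which is [d] times the identity. *)
Lemma teleport_channel (P : X -> 'M[C]_(d * d)) : is_povm P ->
  exists (J : finType) (K : J -> 'M[C]_d), \sum_j (K j)^t* *m K j = 1%:M /\
  forall v Y, qform (kraus K Y) v =
    d%:R^-1 * (\sum_x \tr (P x *m (question x v *t Y))).
Proof.
have [N0 Ureal U1 Udes] := U_design.
move=> [P0 P1]; have /choice[B PB] x := psd_gramP (P0 x).
pose c : C := sqrtC d%:R^-1; have c2 : c * c = d%:R^-1 by rewrite -expr2 sqrtCK.
have cr : c^* = c by rewrite geC0_conj // sqrtC_ge0 invr_ge0 ler0n.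
pose M x r : 'M[C]_d := \matrix_(a, b) B x r (mxtens_index (a, b)).
exists (X * 'I_(d * d))%type, (fun j => c *: ((U j.1)^T *m M j.1 j.2)); split.
  transitivity (d%:R^-1 *: \sum_x \sum_r (M x r)^t* *m M x r).
    rewrite pair_big scaler_sumr; apply: eq_bigr => -[x r] _ /=.
    rewrite trmxCZ cr -scalemxAl -scalemxAr scalerA c2; congr (_ *: _).
    rewrite trmx_mul map_mxM trmxK -!mulmxA [map_mx _ (U x) *m _]mulmxA.
    have -> : map_mx Num.conj (U x) = U x by apply/matrixP => a b; rewrite mxE design_real.
    by rewrite U1 mul1mx.
  apply/matrixP => b e; rewrite !mxE summxE.
  transitivity (d%:R^-1 * \sum_(a < d) (\sum_x P x) (mxtens_index (a, b)) (mxtens_index (a, e))).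
    congr (_ * _); under [RHS]eq_bigr do rewrite summxE.
    rewrite [RHS]exchange_big; apply: eq_bigr => x _; rewrite summxE.
    under [RHS]eq_bigr do rewrite PB mxE.
    rewrite [RHS]exchange_big; apply: eq_bigr => r _; rewrite mxE.
    by apply: eq_bigr => a _; rewrite !mxE.
  rewrite P1 (eq_bigr (fun=> (b == e)%:R)) => [|a _]; last first.
    by rewrite mxE (inj_eq (can_inj (@mxtens_indexK _ _))) xpair_eqE eqxx.
  by rewrite sumr_const card_ord -(mulr_natl (b == e)%:R d) mulKf // pnatr_eq0 -lt0n.
move=> v Y; rewrite qform_sum.
rewrite -(pair_big xpredT xpredT (fun x r =>
  qform ((c *: ((U x)^T *m M x r)) *m Y *m (c *: ((U x)^T *m M x r))^t*) v)) /=.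
rewrite mulr_sumr; apply: eq_bigr => x _; rewrite PB tr_gram_tens.
rewrite /mxtrace mulr_sumr; apply: eq_bigr => r _.
rewrite -c2 trmxCZ cr -!scalemxAl -scalemxAr scalerA qformZ; congr (_ * _).
set y := contract _ _.
(* Contracting with the rotated conjugate of [v] amounts to evaluating the corrected Kraus operator
   against [v]. *)
have yE : row r y = v^t* *m ((U x)^T *m M x r).
  rewrite mulmxA; apply/rowP => b; rewrite !mxE; apply: eq_bigr => a _.
  rewrite [M x r a b]mxE mulrC; congr (_ * _).
  by rewrite !mxE; apply: eq_bigr => i _; rewrite !mxE mulrC.
transitivity ((row r y *m Y *m (row r y)^t*) 0 0).
  by rewrite yE /qform [in RHS]trmx_mul [in RHS]map_mxM trmxCK !mulmxA.
by rewrite -row_mul !mxE; apply: eq_bigr => b _; rewrite !mxE.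
Qed.

End Design.
End Teleportation.

(** * Componentwise continuity and compactness of the set of POVMs *)

Section CompactPovm.
Variable R : realType.
Local Notation C := R[i].
Local Notation Re := complex.Re.
Local Notation Im := complex.Im.

Lemma ReD (x y : C) : Re (x + y) = Re x + Re y. Proof. by case: x y => [a b] []. Qed.

Lemma ImD (x y : C) : Im (x + y) = Im x + Im y. Proof. by case: x y => [a b] []. Qed.

Lemma Re_sum (J : finType) (x : J -> C) : Re (\sum_j x j) = \sum_j Re (x j).
Proof. by elim/big_rec2: _ => // j y z _ <-; rewrite ReD. Qed.

Lemma Im_sum (J : finType) (x : J -> C) : Im (\sum_j x j) = \sum_j Im (x j).
Proof. by elim/big_rec2: _ => // j y z _ <-; rewrite ImD. Qed.

Lemma ReM (x y : C) : Re (x * y) = Re x * Re y - Im x * Im y.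
Proof. by case: x y => [a b] []. Qed.

Lemma ImM (x y : C) : Im (x * y) = Re x * Im y + Im x * Re y.
Proof. by case: x y => [a b] []. Qed.

Section ContinuousComplex.
Variable T : topologicalType.
Implicit Types h : T -> C.

(** Stated by components, so that only the topology of [R] enters. *)
Definition ccontinuous h :=
  continuous (fun t => Re (h t)) /\ continuous (fun t => Im (h t)).

Lemma ccontinuous_cst c : ccontinuous (fun=> c).
Proof. by split=> ?; exact: cvg_cst. Qed.

Lemma ccontinuous_sum (J : finType) (h : J -> T -> C) :
  (forall j, ccontinuous (h j)) -> ccontinuous (fun t => \sum_j h j t).
Proof.
move=> ch; split.
  rewrite (_ : (fun t => _) = (fun t => \sum_j Re (h j t))); last first.
    by apply/funext => t; exact: Re_sum.
  by apply: continuous_sum => j; case: (ch j).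
rewrite (_ : (fun t => _) = (fun t => \sum_j Im (h j t))); last first.
  by apply/funext => t; exact: Im_sum.
by apply: continuous_sum => j; case: (ch j).
Qed.

Lemma ccontinuous_mul h g :
  ccontinuous h -> ccontinuous g -> ccontinuous (fun t => h t * g t).
Proof.
move=> [h1 h2] [g1 g2]; split.
  rewrite (_ : (fun t => _) = (fun t => Re (h t) * Re (g t) - Im (h t) * Im (g t))).
    exact: continuous_sub (continuous_mul h1 g1) (continuous_mul h2 g2).
  by apply/funext => t; exact: ReM.
rewrite (_ : (fun t => _) = (fun t => Re (h t) * Im (g t) + Im (h t) * Re (g t))).
  move=> t; exact: cvgD (continuous_mul h1 g2 (x := t)) (continuous_mul h2 g1 (x := t)).
by apply/funext => t; exact: ImM.
Qed.

Lemma closed_cge0 h : ccontinuous h -> closed [set t | 0 <= h t].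
Proof.
move=> [h1 h2].
rewrite (_ : [set t | _] = [set t | Im (h t) = 0] `&` [set t | 0 <= Re (h t)]).
  by apply: closedI; [exact: closed_eqr|exact: closed_ge0].
apply/seteqP; split=> t /=; rewrite lecE /=; first by move=> /andP[/eqP].
by move=> [-> ->]; rewrite eqxx.
Qed.

Lemma closed_ceq h c : ccontinuous h -> closed [set t | h t = c].
Proof.
move=> [h1 h2].
rewrite (_ : [set t | _] = [set t | Re (h t) = Re c] `&` [set t | Im (h t) = Im c]).
  by apply: closedI; exact: closed_eqr.
apply/seteqP; split=> t /=; first by move=> ->.
by case: (h t) c => [a b] [c d] /= [-> ->].
Qed.

End ContinuousComplex.

Lemma ccontinuous_fst (T U : topologicalType) (h : T -> C) :
  ccontinuous h -> ccontinuous (fun p : T * U => h p.1).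
Proof.
move=> [h1 h2]; split.
  exact: (@continuous_fst_comp _ _ _ (fun t => Re (h t)) h1).
exact: (@continuous_fst_comp _ _ _ (fun t => Im (h t)) h2).
Qed.

Lemma ccontinuous_snd (T U : topologicalType) (h : U -> C) :
  ccontinuous h -> ccontinuous (fun p : T * U => h p.2).
Proof.
move=> [h1 h2]; split.
  exact: (@continuous_snd_comp _ _ _ (fun t => Re (h t)) h1).
exact: (@continuous_snd_comp _ _ _ (fun t => Im (h t)) h2).
Qed.

Variables (X : finType) (n : nat).

(** Real coordinates for families of matrices, the boolean selecting the imaginary part; Tychonoff's
    theorem then applies over [R]. *)
Definition povm_params := prod_topology (fun _ : X * 'I_n * 'I_n * bool => R).

Definition decode_povm (p : povm_params) (x : X) : 'M[C]_n :=
  \matrix_(i, j) (p (x, i, j, false) +i* p (x, i, j, true))%C.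

Definition encode_povm (P : X -> 'M[C]_n) : povm_params :=
  fun k => let: (x, i, j, b) := k in if b then Im (P x i j) else Re (P x i j).

Lemma encode_povmK P : decode_povm (encode_povm P) = P.
Proof.
apply/funext => x; apply/matrixP => i j; rewrite mxE /=.
by case: (P x i j).
Qed.

Lemma ccontinuous_decode x i j : ccontinuous (fun p => decode_povm p x i j).
Proof.
split.
  rewrite (_ : (fun p => _) = (fun p : povm_params => p (x, i, j, false))).
    by move=> p; exact: (@proj_continuous _ (fun=> R) _ p).
  by apply/funext => p; rewrite mxE.
rewrite (_ : (fun p => _) = (fun p : povm_params => p (x, i, j, true))).
  by move=> p; exact: (@proj_continuous _ (fun=> R) _ p).
by apply/funext => p; rewrite mxE.
Qed.

Lemma povm_diag_le1 (P : X -> 'M[C]_n) x i : is_povm P -> P x i i <= 1.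
Proof.
move=> [P0 P1]; have <- : (\sum_y P y) i i = 1 by rewrite P1 mxE eqxx.
by rewrite summxE (bigD1 x) //= lerDl sumr_ge0 // => y _; exact: psd_ge0_diag.
Qed.

Lemma povm_entry_le (P : X -> 'M[C]_n) x i j : is_povm P -> `|P x i j| <= 2.
Proof.
move=> hP; apply: (le_trans (psd_entry_bound i j (hP.1 x))).
by rewrite (_ : 2 = 1 + 1) ?lerD ?povm_diag_le1.
Qed.

(** Positivity is an intersection of closed conditions, one for each vector, and completeness one
    for each entry. Entries have modulus at most [P x i i + P x j j <= 2], so all coordinates lie in
    a compact cube. *)
Lemma compact_povm : compact [set p : povm_params | is_povm (decode_povm p)].
Proof.
have cub := @tychonoff _ (fun _ : X * 'I_n * 'I_n * bool => R) (fun _ => `[(-2), 2]%classic)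
  (fun _ => @segment_compact R (-2) 2).
apply: (subclosed_compact _ cub); last first.
  move=> p hp [[[x i] j] b] /=; rewrite in_itv /= -ler_norml.
  have := povm_entry_le x i j hp; rewrite mxE => le2.
  have RI (z : C) : `|z| <= 2 -> `|Re z| <= 2 /\ `|Im z| <= 2.
    rewrite normc_def => z2.
    have {}z2 : Num.sqrt (Re z ^+ 2 + Im z ^+ 2) <= 2.
      by rewrite -lecR rmorph_nat.
    rewrite -!sqrtr_sqr; split; apply: le_trans z2; rewrite ler_wsqrtr //.
      by rewrite lerDl sqr_ge0.
    by rewrite lerDr sqr_ge0.
  by case: (RI _ le2) => /= ? ?; case: b.
rewrite [X in closed X](_ : _ =
    (\bigcap_(xv in @setT (X * 'cV[C]_n)) [set p | 0 <= qform (decode_povm p xv.1) xv.2]) `&`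
    (\bigcap_(ij in @setT ('I_n * 'I_n)) [set p |
      \sum_x decode_povm p x ij.1 ij.2 = (1%:M : 'M[C]_n) ij.1 ij.2])); last first.
  apply/seteqP; split=> p /=.
    move=> [p0 p1]; split=> [[x v] _|[i j] _] /=; first exact: p0.
    by rewrite -p1 summxE.
  move=> [p0 p1]; split=> [x v|]; first exact: (p0 (x, v)).
  by apply/matrixP => i j; rewrite summxE; exact: (p1 (i, j)).
apply: closedI; apply: closed_bigI => -[a b] _ /=.
  apply: closed_cge0.
  rewrite (_ : (fun p => _) = (fun p => \sum_i \sum_j decode_povm p a i j * ((b i 0)^* * b j 0))).
    apply: ccontinuous_sum => i; apply: ccontinuous_sum => j.
    by apply: ccontinuous_mul; [exact: ccontinuous_decode|exact: ccontinuous_cst].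
  by apply/funext => p; exact: qformE.
by apply: closed_ceq; apply: ccontinuous_sum => x; exact: ccontinuous_decode.
Qed.

End CompactPovm.

(** * Tomographic games and Buscemi's theorem *)

Section Correlations.
Variable R : realType.
Local Notation C := R[i].
Local Notation Re := complex.Re.

Lemma mxtrace_tens a b (A : 'M[C]_a) (B : 'M[C]_b) : \tr (A *t B) = \tr A * \tr B.
Proof.
rewrite /mxtrace sum_mxtens mulr_suml; apply: eq_bigr => i _.
by rewrite mulr_sumr; apply: eq_bigr => j _; rewrite tensmxE.
Qed.

Lemma tens3_tens dA dB a d (Z : 'M[C]_a) (A : 'M[C]_dA) (B : 'M[C]_dB) (H : 'M[C]_d) :
  tens3 Z (A *t B) H = (Z *t A) *t (B *t H).
Proof.
(* Both bracketings of the four indices flatten to the same integer. *)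
have idx (i : 'I_a) (k : 'I_dA) (l : 'I_dB) (m : 'I_d) :
    cast_ord (esym (regroup_dim a dA dB d))
      (mxtens_index (mxtens_index (i, k), mxtens_index (l, m))) =
    mxtens_index (i, mxtens_index (mxtens_index (k, l), m)).
  by apply: val_inj => /=; rewrite !mulnDl !mulnA !addnA.
apply/matrixP => p q; rewrite castmxE /=.
case: (mxtens_indexP p) => p1 p2; case: (mxtens_indexP p1) => i k.
case: (mxtens_indexP p2) => l m; case: (mxtens_indexP q) => q1 q2.
case: (mxtens_indexP q1) => i' k'; case: (mxtens_indexP q2) => l' m'.
by rewrite !idx !tensmxE !mulrA.
Qed.

Lemma tens3_linear dA dB a d (Z : 'M[C]_a) (H : 'M[C]_d) :
  linear (fun M : 'M[C]_(dA * dB) => tens3 Z M H).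
Proof. by move=> c M L; apply/matrixP => p q; rewrite !mxE !castmxE !mxE; ring. Qed.

Lemma tens_linear_ext a b (V : lmodType C) (f g : 'M[C]_(a * b) -> V) :
  linear f -> linear g -> (forall A B, f (A *t B) = g (A *t B)) -> f =1 g.
Proof.
move=> linf ling fg M; rewrite (tens_sum_delta M).
have sumE (J : finType) (x : J -> 'M[C]_(a * b)) :
    (forall j, f (x j) = g (x j)) -> f (\sum_j x j) = g (\sum_j x j).
  move=> fgx; rewrite (eq_bigr (fun j => 1 *: x j)) => [|j _]; last by rewrite scale1r.
  by rewrite !linear_sumZ //; apply: eq_bigr => j _; rewrite fgx.
do 3!apply: (sumE) => ?.
by rewrite !linear_sumZ //; apply: eq_bigr => j _; rewrite fg.
Qed.

Lemma qform_tens_tens a b (A : 'M[C]_a) (B : 'M[C]_b) (v : 'cV[C]_a) (w : 'cV[C]_b) :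
  qform (A *t B) (v *t w) = qform A v * qform B w.
Proof.
rewrite qform_tens !qformE mulr_suml; apply: eq_bigr => i _.
rewrite mulr_suml; apply: eq_bigr => j _; rewrite mulr_sumr; apply: eq_bigr => k _.
by rewrite mulr_sumr; apply: eq_bigr => l _; rewrite tensmxE; ring.
Qed.

Section Game.
Variables (XA XB : finType) (dA dB : nat).
Variables (UA : XA -> 'M[C]_dA) (UB : XB -> 'M[C]_dB) (NA NB : C).
Hypotheses (UA_design : design UA NA) (UB_design : design UB NB).
Hypotheses (dA_gt0 : (0 < dA)%N) (dB_gt0 : (0 < dB)%N).
Local Notation SA := ('I_dA * 'I_dA * bool)%type.
Local Notation SB := ('I_dB * 'I_dB * bool)%type.
Implicit Types (P : XA -> 'M[C]_(dA * dA)) (Q : XB -> 'M[C]_(dB * dB)).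
Implicit Types (rho sigma tau : 'M[C]_(dA * dB)).

(** For each pair of test vectors, the total probability of answering with the announced labels,
    scaled so that Bell measurements return the expectation of [rho] in the product vector. *)
Definition correlation P Q rho (st : SA * SB) : R :=
  (dA%:R * dB%:R)^-1 * \sum_x \sum_y
    Re (\tr ((P x *t Q y) *m tens3 (question UA x (tomo_vec R st.1)) rho
                                   (question UB y (tomo_vec R st.2)))).

(** Both sides are real parts of maps linear in [rho], so product operators suffice; there the trace
    factorises into Alice's and Bob's identities. *)
Lemma correlationE P Q rho (FA : 'M[C]_dA -> 'M[C]_dA) (FB : 'M[C]_dB -> 'M[C]_dB) :
  linear FA -> linear FB ->
  (forall v Y, qform (FA Y) v =
     dA%:R^-1 * \sum_x \tr (P x *m (question UA x v *t Y))) ->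
  (forall v Y, qform (FB Y) v =
     dB%:R^-1 * \sum_y \tr (Q y *m (Y *t question UB y v))) ->
  forall s t, correlation P Q rho (s, t) =
    Re (qform (tensmap FA FB rho) (tomo_vec R s *t tomo_vec R t)).
Proof.
move=> linA linB hA hB s t; rewrite /correlation /=.
have -> : \sum_x \sum_y Re (\tr ((P x *t Q y) *m tens3 (question UA x (tomo_vec R s)) rho
                                   (question UB y (tomo_vec R t)))) =
  Re (\sum_x \sum_y \tr ((P x *t Q y) *m tens3 (question UA x (tomo_vec R s)) rho
                                   (question UB y (tomo_vec R t)))).
  by rewrite Re_sum; apply: eq_bigr => x _; rewrite Re_sum.
have ReZ (c : R) (z : C) : c * Re z = Re (c%:C * z) by rewrite ReM /= mul0r subr0.
rewrite ReZ; congr Re; rewrite fmorphV rmorphM !rmorph_nat.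
set v := tomo_vec R s; set w := tomo_vec R t.
pose f M : C^o := (dA%:R * dB%:R)^-1 * (\sum_x \sum_y
  \tr ((P x *t Q y) *m tens3 (question UA x v) M (question UB y w))).
pose g M : C^o := qform (tensmap FA FB M) (v *t w).
apply: (@tens_linear_ext dA dB C^o f g).
- move=> c M L; rewrite /f.
  rewrite scalerAr -mulrDr; congr (_ * _); rewrite scaler_sumr -big_split; apply: eq_bigr => x _.
  rewrite scaler_sumr -big_split; apply: eq_bigr => y _ /=.
  by rewrite tens3_linear mulmxDr -scalemxAr mxtraceD mxtraceZ.
- by move=> c M L; rewrite /g tensmap_linear /qform mulmxDr mulmxDl -scalemxAr -scalemxAl !mxE.
move=> A B; rewrite /f /g tensmap_tens // qform_tens_tens hA hB invfM mulrACA.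
congr (_ * _); rewrite mulr_suml; apply: eq_bigr => x _; rewrite mulr_sumr.
by apply: eq_bigr => y _; rewrite tens3_tens tensmx_mul mxtrace_tens.
Qed.

Lemma tr_mxswap a (Y H : 'M[C]_a) (M : 'M[C]_(a * a)) :
  \tr (mxswap M *m (H *t Y)) = \tr (M *m (Y *t H)).
Proof. by rewrite -(mxswap_tens Y H) -mxswap_mul mxtrace_swap. Qed.

(** Bell measurements on both sides teleport perfectly: both induced channels are the identity. *)
Lemma correlation_attained rho : exists P Q, [/\ is_povm P, is_povm Q &
  forall s t, correlation P Q rho (s, t) =
    Re (qform rho (tomo_vec R s *t tomo_vec R t))].
Proof.
have [P Ppovm PE] := bell_povm UA_design dA_gt0.
have [Q Qpovm QE] := bell_povm UB_design dB_gt0.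
exists P, (fun y => mxswap (Q y)); split=> // [|s t]; first exact: povm_mxswap.
rewrite (@correlationE _ _ _ id id) //.
- congr (Re (qform _ _)); apply/esym; rewrite -[LHS]/(id rho).
  by apply: tensmap_unique.
- move=> v Y; rewrite -QE; congr (_ * _); apply: eq_bigr => y _.
  by rewrite tr_mxswap.
Qed.

Lemma correlation_channel P Q : is_povm P -> is_povm Q ->
  exists (FA : 'M[C]_dA -> 'M[C]_dA) (FB : 'M[C]_dB -> 'M[C]_dB),
  [/\ channel FA, channel FB,
    forall rho, psdmx rho -> psdmx (tensmap FA FB rho) &
    forall rho s t, correlation P Q rho (s, t) =
      Re (qform (tensmap FA FB rho) (tomo_vec R s *t tomo_vec R t))].
Proof.
move=> Ppovm Qpovm.
have [JA [KA [KA1 KAE]]] := teleport_channel UA_design dA_gt0 Ppovm.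
have [JB [KB [KB1 KBE]]] := teleport_channel UB_design dB_gt0 (povm_mxswap Qpovm).
exists (kraus KA), (kraus KB); split.
- by split=> [|Y]; [exact: kraus_cp|exact: kraus_trace].
- by split=> [|Y]; [exact: kraus_cp|exact: kraus_trace].
- by move=> rho rho0; rewrite tensmap_kraus; exact: psd_kraus.
move=> rho s t; apply: correlationE => //; [exact: kraus_linear|exact: kraus_linear|].
move=> v Y; rewrite KBE; congr (_ * _); apply: eq_bigr => y _.
by rewrite tr_mxswap.
Qed.

Lemma uniform_distr (I : finType) : (0 < #|I|)%N -> is_distr (fun _ : I => #|I|%:R^-1 : R).
Proof.
move=> I0; split=> [_|]; first by rewrite invr_ge0 ler0n.
by rewrite sumr_const -[_ *+ _]mulr_natl mulfV // pnatr_eq0 -lt0n.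
Qed.

Lemma design_card_gt0 (X : finType) d (U : X -> 'M[C]_d) N :
  design U N -> (0 < d)%N -> (0 < #|X|)%N.
Proof.
move=> desU d0; have [N0 _ _ _] := desU.
by rewrite -(ltr0n C) (card_design desU d0) mulr_gt0 // ltr0n.
Qed.

Lemma questions_gt0 (X : finType) d (U : X -> 'M[C]_d) N :
  design U N -> (0 < d)%N -> (0 < #|{: X * ('I_d * 'I_d * bool)}|)%N.
Proof.
move=> desU d0; rewrite !card_prod !card_ord card_bool !muln_gt0 d0.
by rewrite (design_card_gt0 desU d0).
Qed.

(* Only the answers announced in the question are paid, so the weights [w]
   pair the payoff with the averaged correlations. *)
Definition tomo_game (w : SA * SB -> R) : sqgame R :=
  @SQGame R (XA * SA)%type (XB * SB)%type XA XB
    (fun=> #|{: XA * SA}|%:R^-1) (fun=> #|{: XB * SB}|%:R^-1) dA dB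
    (fun xs => question UA xs.1 (tomo_vec R xs.2))
    (fun yt => question UB yt.1 (tomo_vec R yt.2))
    (fun xs yt x y => ((x == xs.1) && (y == yt.1))%:R * w (xs.2, yt.2) *
       (#|{: XA * SA}|%:R * #|{: XB * SB}|%:R / (dA%:R * dB%:R)))
    (uniform_distr (questions_gt0 UA_design dA_gt0))
    (uniform_distr (questions_gt0 UB_design dB_gt0))
    (fun xs => question_state UA_design xs.1 (tomo_vec_unit R xs.2))
    (fun yt => question_state UB_design yt.1 (tomo_vec_unit R yt.2)).

Lemma avg_payoff_tomo_game w P Q rho :
  @avg_payoff R dA dB (tomo_game w) P Q rho = dotp w (correlation P Q rho).
Proof.
pose nA : R := #|{: XA * SA}|%:R; pose nB : R := #|{: XB * SB}|%:R.
have nA0 : nA != 0 by rewrite pnatr_eq0 -lt0n (questions_gt0 UA_design).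
have nB0 : nB != 0 by rewrite pnatr_eq0 -lt0n (questions_gt0 UB_design).
pose o x y s t := Re (\tr ((P x *t Q y) *m tens3 (question UA x (tomo_vec R s)) rho
                                   (question UB y (tomo_vec R t)))).
transitivity (\sum_(xs : XA * SA) \sum_(yt : XB * SB)
   w (xs.2, yt.2) * ((dA%:R * dB%:R)^-1 * o xs.1 yt.1 xs.2 yt.2)).
  apply: eq_bigr => -[x s] _; apply: eq_bigr => -[y t] _.
  rewrite (bigD1 x) //= [X in _ + X]big1 ?addr0 => [|x' xx']; last first.
    by rewrite big1 // => y' _; rewrite (negbTE xx') /= !mul0r mulr0 mul0r.
  rewrite (bigD1 y) //= [X in _ + X]big1 ?addr0 => [|y' yy']; last first.
    by rewrite (negbTE yy') andbF !mul0r mulr0 mul0r.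
  rewrite !eqxx mul1r /outcome_prob /= -/(o x y s t) -/nA -/nB.
  rewrite [RHS]mulrA; congr (_ * _).
  (* The factor [nA * nB] built into the payoff cancels the two uniform priors. *)
  transitivity ((nA^-1 * nA) * (nB^-1 * nB) * (w (s, t) / (dA%:R * dB%:R))).
    by rewrite -/nA; ring.
  by rewrite !mulVf // !mul1r.
transitivity (\sum_(s : SA) \sum_(t : SB) w (s, t) * correlation P Q rho (s, t)); last first.
  by rewrite /dotp pair_bigA; apply: eq_bigr => -[].
pose c : R := (dA%:R * dB%:R)^-1.
rewrite -(pair_bigA _ (fun x s => \sum_(yt : XB * SB) w (s, yt.2) * (c * o x yt.1 s yt.2))) /=.
rewrite exchange_big; apply: eq_bigr => s _.
transitivity (\sum_x \sum_t \sum_y w (s, t) * (c * o x y s t)).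
  apply: eq_bigr => x _.
  rewrite -(pair_bigA _ (fun y t => w (s, t) * (c * o x y s t))) /=.
  by rewrite exchange_big.
rewrite exchange_big; apply: eq_bigr => t _.
rewrite /correlation /= -/c !mulr_sumr; apply: eq_bigr => x _.
by rewrite !mulr_sumr.
Qed.

Lemma continuous_correlation (T : topologicalType) (P : T -> XA -> 'M[C]_(dA * dA))
    (Q : T -> XB -> 'M[C]_(dB * dB)) sigma st :
  (forall x i j, ccontinuous (fun u => P u x i j)) ->
  (forall y i j, ccontinuous (fun u => Q u y i j)) ->
  continuous (fun u => correlation (P u) (Q u) sigma st).
Proof.
move=> cP cQ.
have cc : continuous (fun _ : T => (dA%:R * dB%:R)^-1 : R) by move=> ?; exact: cvg_cst.
apply: (continuous_mul cc).
apply: continuous_sum => x; apply: continuous_sum => y.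
set M := tens3 _ _ _.
suff [] : ccontinuous (fun u => \tr ((P u x *t Q u y) *m M)) by [].
apply: ccontinuous_sum => p.
rewrite (_ : (fun u => _) = (fun u => \sum_q P u x (mxtens_unindex p).1 (mxtens_unindex q).1
   * Q u y (mxtens_unindex p).2 (mxtens_unindex q).2 * M q p)); last first.
  by apply/funext => u; rewrite mxE; apply: eq_bigr => q _; rewrite mxE.
apply: ccontinuous_sum => q; apply: ccontinuous_mul; last exact: ccontinuous_cst.
by apply: ccontinuous_mul.
Qed.

(** The weights of the convex combination found by [in_conv_compact] become the shared randomness,
    and its points, which are pairs of POVMs, become pairs of local channels. *)
Lemma locc_of_games sigma tau : is_state sigma -> is_state tau ->
  (forall G : sqgame R, (pstar G tau <= pstar G sigma)%E) ->
  exists2 L : 'M[C]_(dA * dB) -> 'M[C]_(dA * dB), locc L & L sigma = tau.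
Proof.
move=> [sigma0 _] [tau0 _] le_games.
have [P0 [Q0 [P0povm Q0povm corr0]]] := correlation_attained tau.
pose f (pq : povm_params R XA (dA * dA) * povm_params R XB (dB * dB)) :=
  correlation (decode_povm pq.1) (decode_povm pq.2) sigma.
have cf st : continuous (f^~ st).
  apply: continuous_correlation => x i j.
    exact: (ccontinuous_fst _ (ccontinuous_decode R x i j)).
  exact: (ccontinuous_snd _ (ccontinuous_decode R x i j)).
have cA := compact_setX (@compact_povm R XA (dA * dA)) (@compact_povm R XB (dB * dB)).
have [|k [g [a [gd aA corrE]]]] := in_conv_compact cA (f := f)
    cf (x := correlation P0 Q0 tau).
  (* A functional [w] is the payoff of [tomo_game w], so the ordering of the games is the separation
     condition. The strict inequality below the supremum provides an actual strategy, whether or not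
     the supremum is attained. *)
  move=> w c ltc.
  have : (c%:E < pstar (tomo_game w) sigma)%E.
    apply: lt_le_trans (le_games _).
    apply: (lt_le_trans (y := (avg_payoff (G := tomo_game w) P0 Q0 tau)%:E)).
      by rewrite lte_fin avg_payoff_tomo_game.
    by apply: ereal_sup_ubound; exists P0, Q0.
  move=> /ereal_sup_gt[_ [P [Q [Ppovm Qpovm ->]]]].
  rewrite lte_fin avg_payoff_tomo_game => ltcw.
  by exists (encode_povm P, encode_povm Q); rewrite /f /= !encode_povmK.
have /choice[F FE] w := correlation_channel (aA w).1 (aA w).2.
have /choice[G GE] w := FE w.
have [L Llocc LE] := locc_shared gd (fun w => let: And4 h _ _ _ := GE w in h)
  (fun w => let: And4 _ h _ _ := GE w in h).
exists L => //; apply/eqP; rewrite -subr_eq0; apply/eqP; apply: tomography_tens => s t.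
have L0 : psdmx (L sigma).
  rewrite LE; apply: psd_sum => w; apply: psd_scale.
    by have [g0 _] := gd; rewrite lecR.
  by have [_ _ h _] := GE w; exact: h.
rewrite qformB; apply/eqP; rewrite subr_eq0; apply/eqP.
set u := _ *t _.
(* Correlations record only real parts; this is enough because both operators are positive
   semidefinite and their forms are real. *)
have eqRe (z1 z2 : C) : 0 <= z1 -> 0 <= z2 -> Re z1 = Re z2 -> z1 = z2.
  case: z1 z2 => [x1 y1] [x2 y2]; rewrite !lecE /= => /andP[/eqP -> _] /andP[/eqP -> _].
  by move=> ->.
apply: eqRe; [exact: L0|exact: tau0|].
rewrite -corr0 -corrE /conv_comb LE qform_sum Re_sum; apply: eq_bigr => w _.
have [_ _ _ h] := GE w; rewrite qformZ ReM /= mul0r subr0; congr (_ * _).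
by rewrite /f /= h.
Qed.

End Game.

Lemma entanglement_monotone dA dB (E : forall a b : nat, 'M[C]_(a * b) -> R)
    (sigma tau : 'M[C]_(dA * dB)) :
  entanglement_measure E -> is_state sigma -> is_state tau ->
  (forall G : sqgame R, (pstar G tau <= pstar G sigma)%E) ->
  E dA dB tau <= E dA dB sigma.
Proof.
move=> hE hs ht le_games.
(* A state has trace 1 while an empty matrix has trace 0, so both dimensions are positive, as
   [design_exists] requires. *)
have : (0 < dA * dB)%N.
  rewrite lt0n; apply/negP => /eqP d0; have [_ tr1] := ht.
  have /eqP : 1 = 0 :> C.
    by rewrite -tr1 /mxtrace big1 // => -[i ltid] _; exfalso; rewrite d0 in ltid.
  by rewrite oner_eq0.
rewrite muln_gt0 => /andP[dA0 dB0].
case: dA dA0 sigma tau hs ht le_games => // a _.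
case: dB dB0 => // b _ sigma tau hs ht le_games.
have [XA [UA [NA desA]]] := design_exists R a.
have [XB [UB [NB desB]]] := design_exists R b.
have [L Llocc <-] := locc_of_games desA desB isT isT hs ht le_games.
exact: (ent_locc hE).
Qed.

End Correlations.

Theorem theorem4p1 (R : realType) (dA dB : nat)
  (rho : 'M[R[i]]_(dA * dB)) (rho_state : is_state rho)
  (Rset : povm_set R dA dB)
  (Rset_povm : forall (K : finType) (M : K -> 'M[R[i]]_(dA * dB)),
     Rset K M -> is_povm M)
  (E : forall a b : nat, 'M[R[i]]_(a * b) -> R)
  (E_measure : entanglement_measure E)
  (rhobar : 'M[R[i]]_(dA * dB))
  (rhobar_mem : effective_states Rset rho rhobar)
  (rhobar_eq : forall G : sqgame R, pstar G rhobar = qstar Rset G rho) :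
  effective_entanglement E Rset rho = (E dA dB rhobar)%:E.
Proof.
have [rhobar_state _] := rhobar_mem.
apply/eqP; rewrite eq_le; apply/andP; split.
  by apply: ereal_inf_lbound; exists rhobar.
(* For an effective [sigma], the value of [rhobar] in each game equals [qstar] of [rho], hence is at
   most that of [sigma]; monotonicity of [E] then gives the lower bound. *)
apply: le_ereal_inf_tmp => _ [sigma [sigma_state sigma_ge] <-].
rewrite lee_fin.
apply: (entanglement_monotone E_measure sigma_state rhobar_state) => G.
by rewrite rhobar_eq.
Qed.
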